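(* Let $p\in(0,1)$ be a constant (independent of $n$) and let $p_c=\frac{\sqrt3-1}{\sqrt3}$. As $n\to\infty$: (i) if $p<p_c$, then the probability that ${}^3Q^n_{p}$ has no isolated vertex tends to $0$, and the probability that ${}^3Q^n_p$ is connected tends to $0$; (ii) if $p=p_c$, then the probability that ${}^3Q^n_{p}$ has no isolated vertex tends to $e^{-1}$, and the probability that ${}^3Q^n_{p}$ is connected tends to $e^{-1}$; (iii) if $p>p_c$, then the probability that ${}^3Q^n_{p}$ has no isolated vertex tends to $1$, and the probability that ${}^3Q^n_{p}$ is connected tends to $1$.
   Context: For a positive integer $n$, the 3-cube ${}^3Q^n$ is the simple graph with vertex set $\{0,1,\dots,3^n-1\}$ in which two vertices are adjacent if and only if their ternary (base 3, $n$-digit) representations differ in exactly one digit; equivalently, it is the Cartesian product of $n$ copies of the complete graph $K_3$. For $p\in[0,1]$, the random subgraph ${}^3Q^n_{p}$ contains all vertices of ${}^3Q^n$ and each edge of ${}^3Q^n$ independently with probability $p$. A vertex is isolated if it has no incident edge in the random subgraph. *)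

(* Defs.v *)
From HB Require Import structures.
From mathcomp Require Import all_boot all_order all_algebra.
From mathcomp Require Import all_classical all_reals all_analysis.
Set Implicit Arguments.
Unset Strict Implicit.
Unset Printing Implicit Defensive.
Import Order.TTheory GRing.Theory Num.Theory.
Import numFieldNormedType.Exports.
Local Open Scope ring_scope.

(* A simple graph on T is given by its edge set, a set of two-element sets.  *)
Section Graphs.
Variable T : finType.
Implicit Types (H : {set {set T}}) (x y : T).

Definition edge_rel H : rel T := fun x y => [set x; y] \in H.

Definition isolated_vertex H x : bool := ~~ [exists e in H, x \in e].

Definition no_isolated H : bool := [forall x, ~~ isolated_vertex H x].

(* Only used with T nonempty; an empty T would count as connected. *)
Definition connected_graph H : bool :=
  [forall x, [forall y, connect (edge_rel H) x y]].

Section RandomSubgraph.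
Variables (R : numDomainType) (E : {set {set T}}) (p : R).

(* Product Bernoulli(p) law on the subsets of E: a random subgraph is
   identified with the set H of edges it retains. *)
Definition subgraph_weight H : R :=
  \prod_(e in E) (if e \in H then p else 1 - p).

Definition subgraph_prob (A : pred {set {set T}}) : R :=
  \sum_(H in powerset E | A H) subgraph_weight H.

(* The edges are retained independently with probability p; in particular
   (B = set0) the total mass is 1. *)
Lemma subgraph_prob_superset (B : {set {set T}}) : B \subset E ->
  subgraph_prob (fun H => B \subset H) = p ^+ #|B|.
Proof.
move=> sBE.
pose F e := if e \in E then p else 0.
pose G e := if e \in B then 0 else if e \in E then 1 - p else 1.
have -> : p ^+ #|B| = \prod_e (F e + G e).
  rewrite -prodr_const big_mkcond /=; apply: eq_bigr => e _.
  rewrite /F /G; have [eB|eB] := boolP (e \in B).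
    by rewrite (fintype.subsetP sBE _ eB) addr0.
  by case: ifP => _; rewrite ?add0r // addrC subrK.
rewrite bigA_distr /subgraph_prob big_mkcond /=.
apply: eq_bigr => H _; rewrite powersetE.
have [sHE|/subsetPn[e eH eE]] := boolP (H \subset E); last first.
  by rewrite (bigD1 e) //= eH /F (negbTE eE) mul0r.
have [sBH|/subsetPn[e eB eH]] := boolP (B \subset H); last first.
  by rewrite (bigD1 e) //= (negbTE eH) /G eB mul0r.
rewrite /= /subgraph_weight big_mkcond /=; apply: eq_bigr => e _.
rewrite /F /G; have [eH|eH] := boolP (e \in H).
  by rewrite (fintype.subsetP sHE _ eH).
have -> : (e \in B) = false by apply: contraNF eH => /(fintype.subsetP sBH).
by [].
Qed.

End RandomSubgraph.
End Graphs.

(* Digit of 3 ^ i in the base 3 expansion of x. *)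
Definition ternary_digit (x i : nat) : nat := ((x %/ 3 ^ i) %% 3)%N.

Definition cube3_adj (n : nat) : rel 'I_(3 ^ n) := fun x y =>
  #|[set i : 'I_n | ternary_digit x i != ternary_digit y i]| == 1%N.

Definition cube3_edges (n : nat) : {set {set 'I_(3 ^ n)}} :=
  [set e : {set 'I_(3 ^ n)} |
    [exists x, [exists y, cube3_adj x y && (e == [set x; y])]]].

Definition prob_no_isolated (R : realType) (p : R) (n : nat) : R :=
  subgraph_prob (cube3_edges n) p (@no_isolated _).

Definition prob_connected (R : realType) (p : R) (n : nat) : R :=
  subgraph_prob (cube3_edges n) p (@connected_graph _).

Definition p_c (R : realType) : R := (Num.sqrt 3 - 1) / Num.sqrt 3.

(* Main.v *)
(** The expected number of isolated vertices is [(3 q ^ 2) ^ n] with [q = 1 - p],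
    which is [1] at [p_c].  Bonferroni's inequalities and the convergence of the
    factorial moments (adding a vertex to a set of [j] isolated vertices
    multiplies the probability by [q ^ (2 n)] unless it is adjacent to the set)
    give the limits for isolated vertices, together with Chebyshev's inequality
    below [p_c].

    For connectivity when [3 q ^ 2 <= 1], a set [S] of [s] vertices spans at most
    [s log_3 s] edges, so its edge boundary is entirely absent with probability
    at most [(s / 3 ^ n) ^ s].  Summing over the at most [3 ^ n (2 n) ^ (2 (s - 1))]
    sets of [s] vertices covered by a walk excludes components with
    [2 <= s < 3 ^ n / n ^ 3].  A larger component [A] with [2 |A| <= 3 ^ n] has,
    in some direction [i], at least [3 ^ n / n ^ 4] boundary edges, all absent.
    Removing direction [i] leaves, with high probability, at most [3 ^ n / n ^ 5]
    components, and [A] is a union of some of them; since the edges in direction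
    [i] are independent of the others, a union bound over these unions
    suffices. *)

Require Import Defs.
From mathcomp Require Import all_boot all_order all_algebra.
From mathcomp Require Import all_classical all_reals all_analysis.
From mathcomp Require Import ring lra zify.
Set Implicit Arguments.
Unset Strict Implicit.
Unset Printing Implicit Defensive.
Import Order.TTheory GRing.Theory Num.Theory.
Import numFieldNormedType.Exports.
Import mathcomp.boot.fintype mathcomp.boot.finset mathcomp.boot.fingraph.
Local Open Scope ring_scope.

(** * Random subgraphs *)

Section SubgraphProb.
Variables (T : finType) (R : realFieldType) (E : {set {set T}}) (p : R).
Hypotheses (p_ge0 : 0 <= p) (p_le1 : p <= 1).
Implicit Types (H B : {set {set T}}) (A F G : pred {set {set T}}).

Local Notation w := (subgraph_weight E p).
Local Notation P := (subgraph_prob E p).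
Let q : R := 1 - p.

Lemma subgraph_weight_ge0 H : 0 <= w H.
Proof. by apply: prodr_ge0 => e _; case: ifP => _; rewrite ?subr_ge0. Qed.

Lemma subgraph_prob_ge0 A : 0 <= P A.
Proof. by apply: sumr_ge0 => H _; exact: subgraph_weight_ge0. Qed.

Lemma subgraph_probE A :
  P A = \sum_(H in powerset E) w H * (A H)%:R.
Proof.
rewrite /subgraph_prob big_mkcondr /=; apply: eq_bigr => H _.
by case: (A H); rewrite ?mulr1 ?mulr0.
Qed.

Lemma subgraph_prob_le A F : (forall H, H \subset E -> A H -> F H) -> P A <= P F.
Proof.
move=> sAF; rewrite !subgraph_probE; apply: ler_sum => H; rewrite inE => sHE.
apply: ler_wpM2l; first exact: subgraph_weight_ge0.
by rewrite ler_nat; case AH: (A H) => //; rewrite (sAF H).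
Qed.

Lemma eq_subgraph_prob A F : (forall H, H \subset E -> A H = F H) -> P A = P F.
Proof.
by move=> eqAF; apply/le_anti/andP; split; apply: subgraph_prob_le => H sHE;
  rewrite (eqAF H sHE).
Qed.

Lemma subgraph_probT : P xpredT = 1.
Proof.
rewrite -[RHS](expr0 p) -(@cards0 {set T}).
rewrite -(@subgraph_prob_superset _ _ E) ?sub0set //.
by apply: eq_subgraph_prob => H _; rewrite sub0set.
Qed.

Lemma subgraph_probID F A :
  P A = P (fun H => F H && A H) + P (fun H => ~~ F H && A H).
Proof.
rewrite !subgraph_probE -big_split /=; apply: eq_bigr => H _.
by rewrite -mulrDr; case: (A H); case: (F H); rewrite ?addr0 ?add0r.
Qed.

Lemma subgraph_probU A F : P (fun H => A H || F H) <= P A + P F.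
Proof.
rewrite !subgraph_probE -big_split /=; apply: ler_sum => H _.
rewrite -mulrDr; apply: ler_wpM2l; first exact: subgraph_weight_ge0.
by case: (A H); case: (F H); rewrite /= ?addr0 ?add0r // lerDl.
Qed.

Lemma subgraph_prob_ex (I : finType) (D : pred I) (A : I -> pred {set {set T}}) :
  P (fun H => [exists i in D, A i H]) <= \sum_(i in D) P (A i).
Proof.
under [leRHS]eq_bigr do rewrite subgraph_probE.
rewrite subgraph_probE exchange_big /=; apply: ler_sum => H _.
rewrite -mulr_sumr; apply: ler_wpM2l; first exact: subgraph_weight_ge0.
case: existsP => [[i /andP[Di AiH]]|_]; last by apply: sumr_ge0.
by rewrite (bigD1 i) //= AiH lerDl; apply: sumr_ge0.
Qed.

Lemma subgraph_prob_expect (I : finType) (A : I -> pred {set {set T}}) :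
  \sum_i P (A i) = \sum_(H in powerset E) w H * #|[set i | A i H]|%:R.
Proof.
under eq_bigr do rewrite subgraph_probE.
rewrite exchange_big /=; apply: eq_bigr => H _.
rewrite -mulr_sumr -sum1_card natr_sum [in RHS]big_mkcond /=; congr (_ * _).
by apply: eq_bigr => i _; rewrite inE; case: (A i H).
Qed.

Lemma subgraph_prob_markov (I : finType) (A : I -> pred {set {set T}}) (k : R) :
  P (fun H => k <= #|[set i | A i H]|%:R) * k <= \sum_i P (A i).
Proof.
rewrite subgraph_prob_expect subgraph_probE mulr_suml.
apply: ler_sum => H _; rewrite -mulrA.
apply: ler_wpM2l; first exact: subgraph_weight_ge0.
by case: (leP k) => [|_]; rewrite ?mul1r ?mul0r.
Qed.

(** Factoring the weight of [e] out of the product law leaves the same sum [X] over subgraphs of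
    [E :\ e], whether [e] is kept or not; then [p + q = 1]. *)
Lemma subgraph_prob_absent1 F e : e \in E ->
  (forall H, F (H :\ e) = F H) -> P (fun H => (e \notin H) && F H) = q * P F.
Proof.
move=> eE Fe.
pose X := \sum_(H in powerset (E :\ e) | F H)
  \prod_(f in E :\ e) (if f \in H then p else 1 - p).
have PX : P (fun H => (e \notin H) && F H) = q * X.
  rewrite /X mulr_sumr; apply: eq_big => [H|H].
    by rewrite !powersetE subsetD1 andbA.
  rewrite powersetE => /andP[_ /andP[eH _]].
  rewrite /subgraph_weight (big_setD1 e) //= (negbTE eH); congr (_ * _).
suff PY : P (fun H => (e \in H) && F H) = p * X.
  rewrite (subgraph_probID (fun H => e \in H) F) /=.
  by rewrite PY PX /q; ring.
rewrite /X mulr_sumr /subgraph_prob.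
rewrite (reindex_onto (fun H => e |: H) (fun H => H :\ e)) /=; last first.
  by move=> H /and3P[_ eH _]; rewrite setD1K.
apply: eq_big => [H|H].
  rewrite !powersetE subUset sub1set eE setU11 /= -(Fe (e |: H)).
  rewrite subsetD1; have [eH|eH] := boolP (e \in H).
    rewrite !andbF; apply/negbTE; rewrite negb_and orbC.
    by apply/orP; left; apply/eqP => eq; move: eH; rewrite -eq !inE eqxx.
  by rewrite setU1K // eqxx !andbT.
move=> /andP[/and3P[_ _ _] /eqP eq]; have eH : e \notin H by rewrite -eq !inE eqxx.
rewrite /subgraph_weight (big_setD1 e) //= setU11; congr (_ * _).
by apply: eq_bigr => f; rewrite !inE => /andP[/negbTE-> _].
Qed.

(** Invariance under deletion of edges of [B] says that [F] depends only on the edges outside [B].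
    Such an event is independent of the edges in [B], which are peeled off one at a time. *)
Lemma subgraph_prob_absent F B : B \subset E ->
  (forall e H, e \in B -> F (H :\ e) = F H) ->
  P (fun H => [disjoint H & B] && F H) = q ^+ #|B| * P F.
Proof.
have [k] := ubnP #|B|; elim: k B => // k IH B ltBk sBE FB.
have [B0|[e eB]] := set_0Vmem B.
  rewrite B0 cards0 expr0 mul1r; apply: eq_subgraph_prob => H _.
  by rewrite disjoint_sym disjoints_subset sub0set.
have sB'B : B :\ e \subset B by rewrite subD1set.
have DB : B = e |: B :\ e by rewrite setD1K.
move: ltBk; rewrite (cardsD1 e) eB ltnS => ltBk.
rewrite exprS -mulrA -IH //; first last.
- by move=> f H /(subsetP sB'B); exact: FB.
- exact: subset_trans sBE.
rewrite -(@subgraph_prob_absent1 _ e) ?(subsetP sBE) //.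
  apply: eq_subgraph_prob => H _.
  rewrite {1}DB -!setI_eq0 setIUr setU_eq0 -andbA setI_eq0.
  by rewrite disjoint_sym disjoints1.
move=> H; rewrite FB //; congr (_ && _).
rewrite -!setI_eq0; congr (_ == _); apply/setP => f; rewrite !inE.
by case: (eqVneq f e) => // ->; rewrite !andbF.
Qed.

Lemma subgraph_prob_disjoint B : B \subset E ->
  P (fun H => [disjoint H & B]) = q ^+ #|B|.
Proof.
move=> sBE; rewrite -[RHS]mulr1 -subgraph_probT -subgraph_prob_absent //.
by apply: eq_subgraph_prob => H _; rewrite andbT.
Qed.

End SubgraphProb.

(** * Edge boundaries and components *)

(** Spelled like [cube3_edges], so that [cube3_edges n] and [edge_set (@cube3_adj n)] are
    convertible. *)
Definition edge_set (T : finType) (a : rel T) : {set {set T}} :=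
  [set e : {set T} | [exists x, [exists y, a x y && (e == [set x; y])]]].

Definition edge_cut (T : finType) (a : rel T) (S : {set T}) : {set {set T}} :=
  [set [set z.1; z.2] | z in [set z : T * T |
    [&& z.1 \in S, z.2 \notin S & a z.1 z.2]]].

Definition touching (T : finType) (a : rel T) (B : {set T}) : {set {set T}} :=
  [set e in edge_set a | ~~ [disjoint e & B]].

Definition component (T : finType) (H : {set {set T}}) (x : T) : {set T} :=
  [set y | connect (edge_rel H) x y].

Definition components (T : finType) (H : {set {set T}}) : {set {set T}} :=
  [set component H x | x : T].

Lemma set2_inj (T : finType) (x y u v : T) :
  [set x; y] = [set u; v] -> (x = u /\ y = v) \/ (x = v /\ y = u).
Proof.
move=> eq.
have /set2P xuv : x \in [set u; v] by rewrite -eq set21.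
have /set2P yuv : y \in [set u; v] by rewrite -eq set22.
have /set2P uxy : u \in [set x; y] by rewrite eq set21.
have /set2P vxy : v \in [set x; y] by rewrite eq set22.
by case: xuv => xE; case: yuv => yE; subst; auto; case: uxy; case: vxy; auto.
Qed.

Section Graph.
Variables (T : finType) (a : rel T).
Hypotheses (a_sym : symmetric a) (a_irr : irreflexive a).
Implicit Types (x y : T) (S B : {set T}) (H : {set {set T}}).
Local Open Scope nat_scope.

Lemma mem_edge_set x y : ([set x; y] \in edge_set a) = a x y.
Proof.
rewrite inE; apply/existsP/idP => [[u /existsP[v /andP[auv /eqP]]]|axy].
  by case/set2_inj=> [] [-> ->] //; rewrite a_sym.
by exists x; apply/existsP; exists y; rewrite axy /=.
Qed.

Lemma edge_setP e :
  reflect (exists x y, a x y /\ e = [set x; y]) (e \in edge_set a).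
Proof.
rewrite inE; apply: (iffP existsP) => [[x /existsP[y /andP[axy /eqP ->]]]|].
  by exists x, y.
by case=> x [y [axy ->]]; exists x; apply/existsP; exists y; rewrite axy /=.
Qed.

Lemma edge_rel_sym H : symmetric (edge_rel H).
Proof. by move=> x y; rewrite /edge_rel setUC. Qed.

Lemma edge_rel_sub H : H \subset edge_set a -> subrel (edge_rel H) a.
Proof. by move=> sHa x y /(subsetP sHa); rewrite mem_edge_set. Qed.

Lemma cut_sub S : edge_cut a S \subset edge_set a.
Proof.
apply/subsetP => e /imsetP[[x y]]; rewrite inE => /and3P[_ _ axy] ->.
by rewrite mem_edge_set.
Qed.

Lemma card_cut S :
  #|edge_cut a S| = \sum_(x in S) #|[set y | y \notin S & a x y]|.
Proof.
(* A cut edge has a single endpoint in [S], so its orientation out of [S] is determined. *)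
rewrite card_in_imset; last first.
  move=> [x y] [u v]; rewrite !inE /= => /and3P[xS yS _] /and3P[uS vS _].
  by case/set2_inj => [[-> ->] //|[xv _]]; move: vS; rewrite -xv xS.
rewrite -sum1_card; under [RHS]eq_bigr do rewrite -sum1_card.
rewrite pair_big_dep /=; apply: eq_bigl => -[x y].
by rewrite !inE.
Qed.

(** Degree count; the sum over [S] sees each internal edge twice. *)
Lemma card_cut_regular d S : (forall x, #|[set y | a x y]| = d) ->
  #|edge_cut a S| + \sum_(x in S) #|[set y in S | a x y]| = d * #|S|.
Proof.
move=> da; rewrite card_cut -big_split /= mulnC -sum_nat_const.
apply: eq_bigr => x xS; rewrite -(da x) -[RHS](cardsID S) addnC.
by congr (_ + _); apply: eq_card => y; rewrite !inE // andbC.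
Qed.

Lemma closed_disjoint_cut H S :
  closed (edge_rel H) (mem S) -> [disjoint H & edge_cut a S].
Proof.
move=> clS; rewrite disjoint_sym disjoints_subset; apply/subsetP => e.
move=> /imsetP[[x y]]; rewrite inE /= => /and3P[xS yS _] ->; rewrite inE.
by apply: contra yS => /clS; rewrite /= xS => <-.
Qed.

Lemma isolated_touching H x : H \subset edge_set a ->
  isolated_vertex H x = [disjoint H & touching a [set x]].
Proof.
move=> sHa; rewrite /isolated_vertex -setI_eq0; apply/idP/idP.
  apply: contraR => /set0Pn[e /setIP[eH]]; rewrite inE => /andP[_].
  rewrite disjoint_sym disjoints1 negbK => xe.
  by apply/existsP; exists e; rewrite eH.
apply: contraL => /existsP[e /andP[eH xe]]; apply/set0Pn; exists e.
rewrite in_setI eH inE (subsetP sHa _ eH) /=.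
by rewrite disjoint_sym disjoints1 negbK.
Qed.

Lemma isolated_touching_set H B : H \subset edge_set a ->
  (B \subset [set x | isolated_vertex H x]) = [disjoint H & touching a B].
Proof.
move=> sHa; apply/subsetP/idP => [isoB|HB x xB].
  rewrite -setI_eq0; apply: contraT => /set0Pn[e /setIP[eH]].
  rewrite inE -setI_eq0 => /andP[_ /set0Pn[x /setIP[xe /isoB]]].
  by rewrite inE /isolated_vertex => /existsP[]; exists e; rewrite eH.
rewrite inE isolated_touching //; apply: disjointWr HB.
apply/subsetP => e; rewrite !inE => /andP[->] /=.
by apply: contra => /disjointWr; apply; rewrite sub1set.
Qed.

Lemma touching_sub B : touching a B \subset edge_set a.
Proof. by apply/subsetP => e; rewrite inE => /andP[]. Qed.

Lemma touching0 : touching a set0 = set0.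
Proof.
by apply/setP => e; rewrite !inE disjoint_sym disjoints_subset sub0set andbF.
Qed.

(** Of the [d] edges at [x], those leading into [B] already touch [B]; the others, leading into [D],
    are new. *)
Lemma card_touchingU1 d x B : (forall x, #|[set y | a x y]| = d) -> x \notin B ->
  #|touching a (x |: B)| + #|[set y in B | a x y]| = #|touching a B| + d.
Proof.
move=> da xB.
pose D := [set y | y \notin B & a x y].
have xD : x \notin D by rewrite inE a_irr andbF.
have -> : touching a (x |: B) = touching a B :|: [set [set x; y] | y in D].
  apply/setP => e; apply/idP/idP.
    rewrite in_setU inE => /andP[eE].
    have [eB eBx|eB _] := boolP [disjoint e & B]; last by rewrite inE eE eB.
    apply/orP; right; move: eBx; rewrite -setI_eq0 setIUr setU_eq0.
    rewrite [e :&: B == _]setI_eq0 eB andbT setI_eq0 disjoint_sym disjoints1 negbK.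
    case/edge_setP: eE eB => u [v [auv ->]] eB /set2P[] xE; rewrite -xE in auv eB *.
      apply/imsetP; exists v => //; rewrite inE auv andbT.
      apply: contraL eB => vB; rewrite -setI_eq0.
      by apply/set0Pn; exists v; rewrite !inE eqxx vB orbT.
    apply/imsetP; exists u; rewrite 1?setUC // inE a_sym auv andbT.
    apply: contraL eB => uB; rewrite -setI_eq0.
    by apply/set0Pn; exists u; rewrite !inE eqxx uB.
  rewrite in_setU => /orP[].
    rewrite !inE => /andP[-> /=]; apply: contra => /disjointWr; apply.
    exact: subsetUr.
  case/imsetP => y; rewrite inE => /andP[_ axy ->].
  rewrite inE mem_edge_set axy -setI_eq0; apply/set0Pn; exists x.
  by rewrite !inE eqxx.
rewrite cardsU card_in_imset; last first.
  by move=> y z yD zD /set2_inj[[]//|[E _]]; move: zD; rewrite -E (negbTE xD).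
have -> : touching a B :&: [set [set x; y] | y in D] = set0.
  apply/setP => e; rewrite !inE; apply/negP => /andP[/andP[_ eB]].
  case/imsetP => y; rewrite inE => /andP[yB _] E; move: eB; rewrite E.
  rewrite -setI_eq0 => /set0Pn[z]; rewrite !inE => /andP[/orP[]/eqP->].
    by rewrite (negbTE xB).
  by rewrite (negbTE yB).
rewrite cards0 subn0 -addnA; congr (_ + _).
rewrite -(da x) -[RHS](cardsID B) addnC.
by congr (_ + _); apply: eq_card => y; rewrite !inE // andbC.
Qed.

End Graph.

(** * Connected components: closed sets, counting, covering walks *)

Section Components.
Variables (T : finType) (H : {set {set T}}).
Implicit Types (x y : T) (S A : {set T}).
Local Open Scope nat_scope.
Local Notation e := (edge_rel H).

Lemma connect_edge_sym : connect_sym e.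
Proof. by apply: sym_connect_sym => x y; exact: edge_rel_sym. Qed.

Lemma component_refl x : x \in component H x.
Proof. by rewrite inE connect0. Qed.

Lemma component_eq x y : y \in component H x -> component H y = component H x.
Proof.
rewrite inE => xy; apply/setP => z; rewrite !inE.
by apply/idP/idP => [/(connect_trans xy)//|]; apply: connect_trans; rewrite connect_edge_sym.
Qed.

Lemma closed_component x : closed e (mem (component H x)).
Proof.
move=> y z /connect1 yz; rewrite /= !inE; apply/idP/idP.
  by move/connect_trans; apply.
by move/connect_trans; apply; rewrite connect_edge_sym.
Qed.

Lemma component_subset x A : closed e (mem A) -> x \in A -> component H x \subset A.
Proof.
move=> clA xA; apply/subsetP => y; rewrite inE => /(closed_connect clA) /=.
by rewrite xA => <-.
Qed.

Lemma trivIset_components : trivIset (components H).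
Proof.
apply/trivIsetP => _ _ /imsetP[x _ ->] /imsetP[y _ ->]; apply: contraR.
rewrite -setI_eq0 => /set0Pn[z /setIP[/component_eq <- /component_eq <-]].
by rewrite eqxx.
Qed.

(** A closed set is the union of the components it contains, hence is determined by the family [f A]
    of these components. *)
Lemma card_closed_sets :
  #|[set A : {set T} | [forall x, [forall y, e x y ==> ((x \in A) == (y \in A))]]]|
    <= 2 ^ #|components H|.
Proof.
rewrite -card_powerset.
set X := [set A | _].
have clX A : A \in X -> closed e (mem A).
  rewrite inE => /forallP clA x y exy; apply/eqP.
  by move/forallP/(_ y)/implyP/(_ exy): (clA x).
pose f A := [set C in components H | C \subset A].
rewrite -(@card_in_imset _ _ f X).
  by apply/subset_leq_card/subsetP => _ /imsetP[A _ ->]; rewrite powersetE; apply/subsetP => C; rewrite inE => /andP[].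
have sf A B : A \in X -> f A = f B -> A \subset B.
  move=> /clX clA fAB; apply/subsetP => x xA.
  have : component H x \in f A by rewrite inE imset_f ?component_subset.
  by rewrite fAB inE => /andP[_ /subsetP]; apply; exact: component_refl.
by move=> A B AX BX fAB; apply/eqP; rewrite eqEsubset !sf.
Qed.

(** Each component below size [m] is the component of some counted vertex; the others are disjoint
    and have at least [m] vertices each. *)
Lemma card_components m : 0 < m ->
  #|components H| <= #|[set x | #|component H x| < m]| + #|T| %/ m.
Proof.
move=> m0; rewrite -(cardsID [set C : {set T} | #|C| < m]); apply: leq_add.
  apply: leq_trans (leq_imset_card (component H) _).
  apply/subset_leq_card/subsetP => C; rewrite !inE => /andP[/imsetP[x _ ->] lt].
  by apply: imset_f; rewrite inE.
rewrite leq_divRL // -sum_nat_const.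
have le : #|cover (components H)| <= #|T| by exact: max_card.
apply: leq_trans le.
rewrite -(eqP trivIset_components) [leqRHS](bigID (fun C : {set T} => #|C| < m)) /=.
apply: leq_trans (leq_addl _ _).
rewrite [leqRHS](eq_bigl [in components H :\: [set C : {set T} | #|C| < m]]).
  by apply: leq_sum => C; rewrite !inE -leqNgt => /andP[].
by move=> C; rewrite !inE andbC.
Qed.

(** Two unconnected vertices have disjoint components, and the smaller one fills at most half of the
    vertices. *)
Lemma half_component : ~~ connected_graph H ->
  exists x, (#|component H x|).*2 <= #|T|.
Proof.
rewrite negb_forall => /existsP[x]; rewrite negb_forall => /existsP[y xy].
have dis : component H x :&: component H y = set0.
  apply/eqP; apply: contraR xy => /set0Pn[z /setIP[]].
  by rewrite !inE => xz yz; apply: connect_trans xz _; rewrite connect_edge_sym.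
have : #|component H x :|: component H y| <= #|T| by exact: max_card.
rewrite cardsU dis cards0 subn0 => le.
by case: (leqP #|component H x| #|component H y|) => h; [exists x|exists y]; lia.
Qed.

Lemma component_gt1 x : no_isolated H -> (forall f, f \in H -> #|f| = 2) ->
  1 < #|component H x|.
Proof.
move=> /forallP /(_ x); rewrite negbK => /existsP[f /andP[fH xf]] /(_ _ fH) f2.
have [y yx fE] : exists2 y, y != x & f = [set x; y].
  have : 0 < #|f :\ x| by move: f2; rewrite (cardsD1 x) xf; lia.
  case/card_gt0P=> y /setD1P[yx yf]; exists y => //.
  apply/esym/eqP; rewrite eqEcard f2 cards2 eq_sym yx andbT.
  by apply/subsetP => z /set2P[]->.
have -> : 2 = #|[set x; y]| by rewrite cards2 eq_sym yx.
apply/subset_leq_card/subsetP => z /set2P[]->; rewrite inE ?connect0 //.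
by apply: connect1; rewrite /edge_rel -fE.
Qed.

(** A single vertex would be both connected and isolated. *)
Lemma connected_no_isolated : 1 < #|T| -> connected_graph H -> no_isolated H.
Proof.
move=> T1 /forallP con; apply/forallP => x; rewrite negbK.
have /card_gt0P[y] : 0 < #|[set~ x]| by rewrite cardsC1 -subn1 subn_gt0.
rewrite !inE => yx; have /forallP/(_ y)/connectP[[|z t] /=] := con x.
  by move=> _ eq; rewrite eq eqxx in yx.
move=> /andP[xz _] _; apply/existsP; exists [set x; z].
by rewrite [_ \in H]xz set21.
Qed.

(* A tree on [k] vertices is traversed by a walk of [2 (k - 1)] steps: each new
   vertex [v], reached from [u], is inserted as the detour [u, v, u]. *)
Lemma component_walk x : exists p, [/\ path e x p,
  size p = (#|component H x|.-1).*2 & component H x = [set y in x :: p]].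
Proof.
set C := component H x.
have C0 : 0 < #|C| by apply/card_gt0P; exists x; exact: component_refl.
have walk k : k < #|C| -> exists p, [/\ path e x p, size p = k.*2 &
    [set y in x :: p] \subset C /\ #|[set y in x :: p]| = k.+1].
  elim: k => [|k IH] ltk.
    exists [::]; split => //; have -> : [set y in [:: x]] = [set x].
      by apply/setP => y; rewrite !inE.
    by rewrite cards1 sub1set component_refl.
  have [p [xp sp [sC cC]]] := IH (ltnW ltk).
  set S := [set y in x :: p] in sC cC.
  (* Some edge leaves [S]: otherwise [S] would be closed and contain all of [C], which is larger. *)
  have [u [v [uS vS euv]]] : exists u v, [/\ u \in S, v \notin S & e u v].
    have [/existsP[u /existsP[v /and3P[? ? ?]]]|] :=
      boolP [exists u, exists v, [&& u \in S, v \notin S & e u v]].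
      by exists u, v.
    rewrite negb_exists => /forallP noS.
    have clS : closed e (mem S).
      apply: intro_closed => [|u v euv uS]; first exact: connect_edge_sym.
      have := noS u; rewrite negb_exists => /forallP/(_ v).
      by rewrite [u \in S]uS euv andbT /= negbK.
    have /subset_leq_card : C \subset S by apply: component_subset; rewrite ?inE ?eqxx.
    by rewrite cC leqNgt ltk.
  have [p1 [p2 [pE p1u]]] : exists p1 p2, p = p1 ++ p2 /\ last x p1 = u.
    have /splitPl[p1 p2 <-] : u \in x :: p by rewrite inE in uS.
    by exists p1, p2.
  exists (p1 ++ [:: v, u & p2]); split.
  - move: xp; rewrite pE !cat_path p1u /= => /andP[-> ->].
    by rewrite euv edge_rel_sym euv.
  - by move: sp; rewrite pE !size_cat /= !addnS => ->.
  have -> : [set y in x :: p1 ++ [:: v, u & p2]] = v |: S.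
    apply/setP => y; rewrite !(inE, mem_cat) pE mem_cat.
    have : y == u -> (y == x) || (y \in p1).
      by move/eqP->; rewrite -p1u -in_cons mem_last.
    by case: (y == u); case: (y == x); case: (y \in p1); case: (y == v);
      case: (y \in p2) => //= /(_ isT).
  rewrite cardsU1 vS cC subUset sub1set sC andbT; split => //.
  have uC : u \in C by apply: (subsetP sC).
  by have := @closed_component x u v euv; rewrite /= -/C uC => <-.
have [p [xp sp [sC cC]]] : exists p, [/\ path e x p, size p = (#|C|.-1).*2 &
    [set y in x :: p] \subset C /\ #|[set y in x :: p]| = #|C|.-1.+1].
  by apply: walk; rewrite prednK.
exists p; split=> //; apply/esym/eqP.
by rewrite eqEcard sC cC prednK /=.
Qed.

End Components.

(** * Edge isoperimetry *)

Section Isoperimetry.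
Local Open Scope nat_scope.

Lemma leq_expnl m n k : m <= n -> m ^ k <= n ^ k.
Proof. by case: k => // k; rewrite leq_exp2r. Qed.

(* With [x = a - b] and [y = b - c], the right-hand side is
   [s ^ x * (s ^ 2) ^ y * (s ^ 3) ^ c], and [s ^ 2 >= 3ab], [s ^ 3 >= 27abc]. *)
Lemma entropy3_sorted a b c : c <= b -> b <= a ->
  3 ^ (b + c.*2) * (a ^ a * b ^ b * c ^ c) <= (a + b + c) ^ (a + b + c).
Proof.
move=> cb ba; set s := a + b + c.
have -> : 3 ^ (b + c.*2) * (a ^ a * b ^ b * c ^ c) =
    a ^ (a - b) * (3 * (a * b)) ^ (b - c) * (27 * (a * b * c)) ^ c.
  have aE : a ^ a = a ^ (a - b) * a ^ (b - c) * a ^ c.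
    by rewrite -!expnD; congr (_ ^ _); lia.
  have bE : b ^ b = b ^ (b - c) * b ^ c by rewrite -!expnD; congr (_ ^ _); lia.
  have -> : 3 ^ (b + c.*2) = 3 ^ (b - c) * 27 ^ c.
    by rewrite -[27]/(3 ^ 3) -expnM -expnD; congr (_ ^ _); lia.
  rewrite !expnMn {1}aE {1}bE; ring.
have -> : s ^ s = s ^ (a - b) * (s ^ 2) ^ (b - c) * (s ^ 3) ^ c.
  by rewrite -!expnM -!expnD; congr (_ ^ _); rewrite /s; lia.
have [x ax] : exists x, a = b + x by exists (a - b); lia.
have [y bE] : exists y, b = c + y by exists (b - c); lia.
apply: leq_mul; first apply: leq_mul.
- by apply: leq_expnl; rewrite /s; lia.
- by apply: leq_expnl; rewrite /s; nia.
- by apply: leq_expnl; rewrite /s ax bE; nia.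
Qed.

(** In a sorted triple the pairwise minima add up to the middle entry plus twice the least, so the
    sorted case suffices by symmetry. The minima will bound the matchings between the three layers
    of a vertex set. *)
Lemma entropy3 a b c :
  3 ^ (minn a b + minn a c + minn b c) * (a ^ a * b ^ b * c ^ c)
    <= (a + b + c) ^ (a + b + c).
Proof.
have sorted x y z : z <= y -> y <= x ->
    3 ^ (minn x y + minn x z + minn y z) * (x ^ x * y ^ y * z ^ z)
      <= (x + y + z) ^ (x + y + z).
  move=> zy yx; have := entropy3_sorted zy yx.
  by have -> : minn x y + minn x z + minn y z = y + z.*2 by lia.
have perm x y z : x + y + z = a + b + c ->
    minn x y + minn x z + minn y z = minn a b + minn a c + minn b c ->
    x ^ x * y ^ y * z ^ z = a ^ a * b ^ b * c ^ c -> z <= y -> y <= x ->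
    3 ^ (minn a b + minn a c + minn b c) * (a ^ a * b ^ b * c ^ c)
      <= (a + b + c) ^ (a + b + c).
  by move=> e1 e2 e3 zy yx; have := sorted _ _ _ zy yx; rewrite e1 e2 e3.
have /orP[ab|ba] := leq_total a b; have /orP[bc|cb] := leq_total b c;
  have /orP[ac|ca] := leq_total a c.
- by apply: (perm c b a); [lia|lia|ring| |].
- by apply: (perm c b a); [lia|lia|ring| |lia].
- by apply: (perm b c a); [lia|lia|ring| |].
- by apply: (perm b a c); [lia|lia|ring| |].
- by apply: (perm c a b); [lia|lia|ring| |].
- by apply: (perm a c b); [lia|lia|ring| |].
- by apply: (perm a b c); [lia|lia|ring| |lia].
- by apply: (perm a b c); [lia|lia|ring| |].
Qed.

Section Digits.
Variables (T : finType) (dg : nat -> T -> 'I_3).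
Implicit Types (x y z : T) (S : {set T}).

(** Hamming distance on the first [k] digits; varying [k] allows induction on the dimension over a
    fixed vertex type. *)
Definition digit_dist k x y := \sum_(i < k) (dg i x != dg i y).

(** Pairs are ordered, so this is twice the number of edges spanned by [S]. *)
Definition adjacent_pairs k S :=
  \sum_(x in S) \sum_(y in S) (digit_dist k x y == 1).

Lemma digit_distS k x y :
  digit_dist k.+1 x y = digit_dist k x y + (dg k x != dg k y).
Proof. by rewrite /digit_dist big_ord_recr. Qed.

Lemma digit_distC k x y : digit_dist k x y = digit_dist k y x.
Proof. by apply: eq_bigr => i _; rewrite eq_sym. Qed.

Lemma digit_dist_eq0 k x y :
  reflect (forall i, i < k -> dg i x = dg i y) (digit_dist k x y == 0).
Proof.
apply: (iffP idP) => [|eq].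
  rewrite sum_nat_eq0 => /forallP h i ltik.
  by have := h (Ordinal ltik); rewrite /= eqb0 negbK => /eqP.
by rewrite sum_nat_eq0; apply/forallP => i /=; rewrite eq ?eqxx.
Qed.

(** The first [k] digits separate the points of [B], so each [x] in [A] agrees with at most one of
    them. *)
Lemma sum_matching_le k (A B : {set T}) :
  {in B &, forall y z, digit_dist k y z = 0 -> y = z} ->
  \sum_(x in A) \sum_(y in B) (digit_dist k x y == 0) <= #|A|.
Proof.
move=> injB; rewrite -sum1_card; apply: leq_sum => x _.
have [/existsP[y /andP[yB xy]]|noy] := boolP [exists y, (y \in B) && (digit_dist k x y == 0)].
  rewrite (bigD1 y) //= xy big1 // => z /andP[zB zy]; apply/eqP; rewrite eqb0.
  apply: contra zy => /digit_dist_eq0 xz; apply/eqP/injB => //.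
  by apply/eqP/digit_dist_eq0 => i ik; rewrite -xz // (digit_dist_eq0 _ _ _ xy).
rewrite big1 // => y yB; apply/eqP; rewrite eqb0.
by move: noy; rewrite negb_exists => /forallP/(_ y); rewrite yB.
Qed.

(** In logarithms: [S] spans at most [s log_3 s] edges. Split [S] by digit [k]: pairs within a layer
    fall under the induction hypothesis, pairs across two layers agree in the first [k] digits and
    form a matching, and [entropy3] absorbs the matchings. The separation hypothesis passes to the
    layers. *)
Lemma edge_isoperimetry k S :
  {in S &, forall x y, digit_dist k x y = 0 -> x = y} ->
  3 ^ adjacent_pairs k S <= (#|S| ^ #|S|) ^ 2.
Proof.
elim: k S => [|k IH] S injS.
  rewrite /adjacent_pairs big1; last first.
    by move=> x _; rewrite big1 // => y _; rewrite /digit_dist big_ord0.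
  by rewrite expn0 !expn_gt0; case: #|S|.
pose t0 : 'I_3 := ord0; pose t1 : 'I_3 := lift ord0 ord0.
pose t2 : 'I_3 := lift ord0 (lift ord0 ord0).
pose L (c : 'I_3) := [set x in S | dg k x == c].
have sum3 (F : T -> nat) : \sum_(x in S) F x =
    \sum_(x in L t0) F x + \sum_(x in L t1) F x + \sum_(x in L t2) F x.
  rewrite (partition_big (dg k) xpredT) //= !big_ord_recl big_ord0 addn0 addnA.
  by congr (_ + _ + _); apply: eq_bigl => x; rewrite inE.
have injL c d : {in L c & L d, forall x y, digit_dist k x y = 0 -> c = d -> x = y}.
  move=> x y; rewrite !inE => /andP[xS /eqP xc] /andP[yS /eqP yd] xy cd.
  by apply: injS; rewrite // digit_distS xy xc yd cd eqxx.
have injLL c : {in L c &, forall x y, digit_dist k x y = 0 -> x = y}.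
  by move=> x y xc yc /(injL c c x y xc yc); apply.
pose M c d := \sum_(x in L c) \sum_(y in L d) (digit_dist k x y == 0).
have leM c d : M c d <= minn #|L c| #|L d|.
  rewrite leq_min sum_matching_le //= /M exchange_big /=.
  under eq_bigr do under eq_bigr do rewrite digit_distC.
  by rewrite sum_matching_le.
have eqL c x y : x \in L c -> y \in L c ->
    (digit_dist k.+1 x y == 1) = (digit_dist k x y == 1).
  rewrite !inE => /andP[_ /eqP xc] /andP[_ /eqP yc].
  by rewrite digit_distS xc yc eqxx addn0.
have neqL c d x y : c != d -> x \in L c -> y \in L d ->
    (digit_dist k.+1 x y == 1) = (digit_dist k x y == 0).
  rewrite !inE => cd /andP[_ /eqP xc] /andP[_ /eqP yd].
  by rewrite digit_distS xc yd cd addn1.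
have pairs_eq c : \sum_(x in L c) \sum_(y in L c) (digit_dist k.+1 x y == 1)
    = adjacent_pairs k (L c).
  by apply: eq_bigr => x xc; apply: eq_bigr => y yc; rewrite (eqL c).
have pairs_neq c d : c != d ->
    \sum_(x in L c) \sum_(y in L d) (digit_dist k.+1 x y == 1) = M c d.
  by move=> cd; apply: eq_bigr => x xc; apply: eq_bigr => y yc; rewrite (neqL c d).
have SE : #|S| = #|L t0| + #|L t1| + #|L t2| by rewrite -!sum1_card sum3.
have -> : adjacent_pairs k.+1 S =
    adjacent_pairs k (L t0) + adjacent_pairs k (L t1) + adjacent_pairs k (L t2)
    + (M t0 t1 + M t0 t2 + M t1 t0 + M t1 t2 + M t2 t0 + M t2 t1).
  rewrite /adjacent_pairs sum3.
  under eq_bigr do rewrite sum3.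
  under [X in _ + X + _]eq_bigr do rewrite sum3.
  under [X in _ + X]eq_bigr do rewrite sum3.
  rewrite !big_split /= !pairs_eq !pairs_neq // /adjacent_pairs.
  lia.
rewrite SE; set a := #|L t0|; set b := #|L t1|; set c := #|L t2|.
set m := minn a b + minn a c + minn b c.
(* Each of the three matchings is counted in both orders, hence [m.*2]. *)
apply: (@leq_trans (3 ^ (adjacent_pairs k (L t0) + adjacent_pairs k (L t1) +
    adjacent_pairs k (L t2) + m.*2))).
  rewrite leq_exp2l // leq_add2l.
  have := leM t0 t1; have := leM t0 t2; have := leM t1 t0; have := leM t1 t2.
  by have := leM t2 t0; have := leM t2 t1; rewrite /m -/a -/b -/c; lia.
have := IH _ (injLL t0); have := IH _ (injLL t1); have := IH _ (injLL t2).
rewrite -/a -/b -/c => h2 h1 h0.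
rewrite !expnD -muln2 expnM.
apply: (leq_trans (leq_mul (leq_mul (leq_mul h0 h1) h2) (leqnn _))).
by rewrite -!expnMn; apply: leq_expnl; rewrite -!expnD mulnC; exact: entropy3.
Qed.

End Digits.
End Isoperimetry.

(** * Walks and the ternary cube *)

Section Walks.
Variables (T : finType) (R : realFieldType) (a b : rel T) (d : nat) (p : R).
Hypotheses (p_ge0 : 0 <= p) (p_le1 : p <= 1).
Hypotheses (b_sym : symmetric b) (b_sub : subrel b a).
Hypothesis (b_deg : forall x, (#|[set y | b x y]| <= d)%N).
Local Notation P := (subgraph_prob (edge_set a) p).
Local Notation q := (1 - p).

Lemma card_walks k x : (#|[set t : k.-tuple T | path b x t]| <= d ^ k)%N.
Proof.
elim: k x => [|k IH] x.
  by apply: leq_trans (max_card _) _; rewrite card_tuple.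
have sub : [set t : k.+1.-tuple T | path b x t] \subset
    \bigcup_(y in [set y | b x y])
      [set cons_tuple y t | t in [set t : k.-tuple T | path b y t]].
  apply/subsetP => t; case/tupleP: t => y t; rewrite inE /= => /andP[xy yt].
  by apply/bigcupP; exists y; rewrite ?inE //; apply: imset_f; rewrite inE.
apply: leq_trans (subset_leq_card sub) _.
rewrite (@leq_trans (\sum_(y in [set y | b x y])
    #|[set cons_tuple y t | t in [set t : k.-tuple T | path b y t]]|)%N) //.
  elim/big_rec2: _ => [|y m B _ le]; first by rewrite cards0.
  by apply: leq_trans (leq_card_setU _ _) _; rewrite leq_add2l.
rewrite expnS; apply: leq_trans (leq_mul (b_deg x) (leqnn _)).
rewrite -sum_nat_const; apply: leq_sum => y _.
exact: leq_trans (leq_imset_card _ _) (IH y).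
Qed.

Lemma edge_set_sub : edge_set b \subset edge_set a.
Proof.
apply/subsetP => e /(edge_setP b)[x [y [bxy ->]]].
rewrite inE; apply/existsP; exists x; apply/existsP; exists y.
by rewrite b_sub /=.
Qed.

Lemma subgraph_prob_cut (S : {set T}) : P (fun H => [disjoint H & edge_cut b S]) = q ^+ #|edge_cut b S|.
Proof.
apply: subgraph_prob_disjoint => //.
exact: subset_trans (cut_sub b_sym S) edge_set_sub.
Qed.

Lemma disjointI_cut (H : {set {set T}}) (S : {set T}) :
  [disjoint H :&: edge_set b & edge_cut b S] = [disjoint H & edge_cut b S].
Proof.
rewrite -!setI_eq0 -setIA [edge_set b :&: _](setIidPr _) //.
exact: cut_sub.
Qed.

(* Union bound over the walks that traverse the component. *)
Lemma prob_component_card x s (theta : R) :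
  0 <= theta -> (forall S : {set T}, #|S| = s -> q ^+ #|edge_cut b S| <= theta) ->
  P (fun H => #|component (H :&: edge_set b) x| == s) <=
    (d ^ (s.-1).*2)%:R * theta.
Proof.
move=> theta_ge0 le_theta.
pose vs (t : (s.-1).*2.-tuple T) := [set y in x :: t].
pose A (t : (s.-1).*2.-tuple T) (H : {set {set T}}) := (#|vs t| == s) && [disjoint H & edge_cut b (vs t)].
(* The walks are taken in the fixed graph [b] rather than in [H], so that the family does not depend
   on the random subgraph. *)
pose W := [set t : (s.-1).*2.-tuple T | path b x t].
have theta0 t : t \in W -> P (A t) <= (#|vs t| == s)%:R * theta.
  move=> _; rewrite /A; case: eqP => [eq|_] /=; last first.
    rewrite mul0r subgraph_probE big1 // => H _; exact: mulr0.
  by rewrite mul1r subgraph_prob_cut le_theta.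
apply: (@le_trans _ _ (\sum_(t in W) P (A t))).
  apply: le_trans (subgraph_prob_ex _ p_ge0 p_le1 _ _) => //.
  apply: subgraph_prob_le => // H sHE /eqP cs.
  have [t [xt st Ct]] := component_walk (H :&: edge_set b) x.
  rewrite cs in st; apply/existsP; exists (Tuple (introT eqP st)).
  rewrite inE /= /A /vs /= -Ct cs eqxx /= -disjointI_cut.
  rewrite closed_disjoint_cut ?andbT; last exact: closed_component.
  apply: sub_path xt; apply: edge_rel_sub => //; exact: subsetIr.
apply: (@le_trans _ _ (\sum_(t in W) theta)).
  apply: ler_sum => t /theta0 /le_trans; apply.
  by case: eqP; rewrite ?mul1r ?mul0r.
rewrite sumr_const -[leLHS]mulr_natl; apply: ler_wpM2r => //.
by rewrite ler_nat card_walks.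
Qed.

End Walks.

(** * The ternary cube: digits, directions and edge boundaries *)

Section CubeGraph.
Variable n : nat.
Local Notation T := 'I_(3 ^ n).
Local Open Scope nat_scope.

Definition cube_digit (i : nat) (x : T) : 'I_3 := inord (ternary_digit x i).

Local Notation dist := (digit_dist cube_digit n).

Lemma cube_digit_eq i (x y : T) :
  (cube_digit i x == cube_digit i y) = (ternary_digit x i == ternary_digit y i).
Proof. by rewrite -val_eqE /= !inordK // ltn_pmod. Qed.

Lemma cube3_adjE (x y : T) : cube3_adj x y = (dist x y == 1).
Proof.
rewrite /cube3_adj -sum1_card big_mkcond /=; congr (_ == _).
by apply: eq_bigr => i _; rewrite inE cube_digit_eq; case: eqP.
Qed.

(** Reading digits from the top, the quotients by [3 ^ (n - k)] agree for every [k <= n]; at [k = n]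
    they are the numbers themselves. *)
Lemma cube_digit_inj (x y : T) : dist x y = 0 -> x = y.
Proof.
move/eqP/digit_dist_eq0 => eq; apply/val_inj => /=.
have h k : k <= n -> x %/ 3 ^ (n - k) = y %/ 3 ^ (n - k).
  elim: k => [|k IH] lekn; first by rewrite subn0 !divn_small.
  have E : n - k = (n - k.+1).+1 by lia.
  rewrite (divn_eq (x %/ 3 ^ (n - k.+1)) 3) (divn_eq (y %/ 3 ^ (n - k.+1)) 3).
  rewrite -!divnMA -!expnSr -E IH ?(ltnW lekn) //.
  congr (_ + _); apply/eqP; rewrite -[_ == _]cube_digit_eq; apply/eqP/eq; lia.
by have := h n (leqnn n); rewrite subnn !divn1.
Qed.

Lemma cube3_adj_sym : symmetric (@cube3_adj n).
Proof. by move=> x y; rewrite !cube3_adjE digit_distC. Qed.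

Lemma digit_dist_refl (x : T) : dist x x = 0.
Proof. by apply/eqP/digit_dist_eq0. Qed.

Lemma cube3_adj_irr : irreflexive (@cube3_adj n).
Proof. by move=> x; rewrite cube3_adjE digit_dist_refl. Qed.

Definition dir_adj (i : 'I_n) : rel T := fun x y =>
  cube3_adj x y && (cube_digit i x != cube_digit i y).

(** The edges in the directions other than [i]: three disjoint cubes of dimension [n - 1], on the
    same vertex type. *)
Definition codir_adj (i : 'I_n) : rel T := fun x y =>
  cube3_adj x y && (cube_digit i x == cube_digit i y).

Lemma codir_adj_sym i : symmetric (codir_adj i).
Proof. by move=> x y; rewrite /codir_adj cube3_adj_sym eq_sym. Qed.

Lemma codir_adj_sub i : subrel (codir_adj i) (@cube3_adj n).
Proof. by move=> x y /andP[]. Qed.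

Lemma dir_adj_sub i : subrel (dir_adj i) (@cube3_adj n).
Proof. by move=> x y /andP[]. Qed.

Lemma cube3_adj_split i (x y : T) :
  (cube3_adj x y : nat) = dir_adj i x y + codir_adj i x y.
Proof. by rewrite /dir_adj /codir_adj; case: cube3_adj => //=; case: eqP. Qed.

Lemma cube3_adj_sum (x y : T) : (cube3_adj x y : nat) = \sum_i dir_adj i x y.
Proof.
rewrite /dir_adj; case xy: (cube3_adj x y); last by rewrite big1.
by move: xy; rewrite cube3_adjE => /eqP.
Qed.

(** Digits can be prescribed freely: [code] is injective between sets of [3 ^ n] elements, hence
    bijective, and [f c] puts [c] in place of digit [i] of [x]. *)
Lemma dir_adj_deg i (x : T) : #|[set y | dir_adj i x y]| = 2.
Proof.
pose code (y : T) : {ffun 'I_n -> 'I_3} := [ffun j : 'I_n => cube_digit j y].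
have code_inj : injective code.
  move=> y z /ffunP eq; apply: cube_digit_inj; apply/eqP/digit_dist_eq0 => j jn.
  by have := eq (Ordinal jn); rewrite !ffunE.
have [g gK Kg] : bijective code.
  by apply: inj_card_bij code_inj _; rewrite card_ffun !card_ord.
pose f c := g [ffun j => if j == i then c else cube_digit j x].
have fE c (j : 'I_n) : cube_digit j (f c) = if j == i then c else cube_digit j x.
  have /ffunP/(_ j) := Kg [ffun j => if j == i then c else cube_digit j x].
  by rewrite !ffunE.
have -> : [set y | dir_adj i x y] = [set f c | c in [set~ cube_digit i x]].
  apply/setP => y; rewrite inE; apply/idP/imsetP => [|[c cx ->]].
    rewrite /dir_adj cube3_adjE => /andP[/eqP d1 xy].
    exists (cube_digit i y); first by rewrite !inE eq_sym.
    apply: cube_digit_inj; apply/eqP/digit_dist_eq0 => j jn.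
    rewrite (fE _ (Ordinal jn)); case: eqP => [<- //|/eqP ji].
    apply/eqP; apply: contraT => yx; move: d1.
    rewrite /digit_dist (bigD1 i) //= (bigD1 (Ordinal jn)) //= xy eq_sym yx.
    by [].
  have {}cx : cube_digit i x != c by move: cx; rewrite !inE eq_sym.
  rewrite /dir_adj cube3_adjE fE eqxx cx andbT /digit_dist.
  rewrite (bigD1 i) //= fE eqxx cx big1 // => j ji.
  by rewrite fE (negbTE ji) eqxx.
rewrite card_imset; first by rewrite cardsC1 card_ord.
by move=> c c' eq; have := fE c i; rewrite eq fE eqxx.
Qed.

Lemma cube3_adj_deg (x : T) : #|[set y | cube3_adj x y]| = 2 * n.
Proof.
rewrite -sum1_card big_mkcond /=.
transitivity (\sum_(y : T) \sum_i (dir_adj i x y : nat)).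
  by apply: eq_bigr => y _; rewrite inE -cube3_adj_sum; case: cube3_adj.
rewrite exchange_big /= (_ : 2 * n = \sum_(i < n) 2); last by rewrite sum_nat_const card_ord mulnC.
apply: eq_bigr => i _; rewrite -[RHS](dir_adj_deg i x) -sum1_card [RHS]big_mkcond /=.
by apply: eq_bigr => y _; rewrite inE; case: dir_adj.
Qed.

Lemma codir_adj_deg i (x : T) : #|[set y | codir_adj i x y]| <= 2 * n.
Proof.
rewrite -(cube3_adj_deg x); apply/subset_leq_card/subsetP => y.
by rewrite !inE => /codir_adj_sub.
Qed.

Lemma card_cut_sum (a : rel T) S :
  #|edge_cut a S| = \sum_(x in S) \sum_(y in ~: S) (a x y : nat).
Proof.
rewrite card_cut; apply: eq_bigr => x _.
rewrite -sum1_card [LHS]big_mkcond [RHS]big_mkcond /=.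
by apply: eq_bigr => y _; rewrite !inE; case: (y \in S); case: (a x y).
Qed.

Lemma card_cut_dir (S : {set T}) :
  \sum_i #|edge_cut (dir_adj i) S| = #|edge_cut (@cube3_adj n) S|.
Proof.
rewrite card_cut_sum.
under eq_bigr => i _ do
  rewrite card_cut_sum.
rewrite exchange_big /=; apply: eq_bigr => x _.
rewrite exchange_big /=; apply: eq_bigr => y _.
by rewrite cube3_adj_sum.
Qed.

(** Dropping direction [i] loses at most the two edges in that direction at each vertex of [S]. *)
Lemma card_cut_codir i (S : {set T}) :
  #|edge_cut (@cube3_adj n) S| <= #|edge_cut (codir_adj i) S| + 2 * #|S|.
Proof.
rewrite card_cut_sum.
rewrite (card_cut_sum (codir_adj i)).
rewrite mulnC -sum_nat_const -big_split /=; apply: leq_sum => x _.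
under eq_bigr do rewrite (cube3_adj_split i).
rewrite big_split /= addnC leq_add2l -[leqRHS](dir_adj_deg i x) -sum1_card.
rewrite [leqLHS]big_mkcond [leqRHS]big_mkcond /=; apply: leq_sum => y _.
by rewrite !inE; case: (y \in S); case: dir_adj.
Qed.

(** The degree count subtracts the internal pairs, bounded by [edge_isoperimetry], from [2 n s]; in
    logarithms, the boundary has at least [2 s (n - log_3 s)] edges. *)
Lemma cut_isoperimetry (S : {set T}) :
  (3 ^ n) ^ (2 * #|S|) <= 3 ^ #|edge_cut (@cube3_adj n) S| * (#|S| ^ #|S|) ^ 2.
Proof.
have pairs : adjacent_pairs cube_digit n S =
    \sum_(x in S) #|[set y in S | cube3_adj x y]|.
  apply: eq_bigr => x _; rewrite -sum1_card [LHS]big_mkcond [RHS]big_mkcond /=.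
  by apply: eq_bigr => y _; rewrite inE -cube3_adjE; case: (y \in S); case: cube3_adj.
have := card_cut_regular S cube3_adj_deg.
rewrite -pairs => eq.
have -> : (3 ^ n) ^ (2 * #|S|) = 3 ^ (2 * n * #|S|).
  by rewrite -expnM; congr (_ ^ _); ring.
rewrite -eq expnD leq_mul2l; apply/orP; right.
by apply: edge_isoperimetry => x y _ _; exact: cube_digit_inj.
Qed.

(** Replacing [3 ^ n] by [2 s] in [cut_isoperimetry] and cancelling [s ^ (2 s)] bounds [4 ^ s],
    hence [3 ^ s], by 3 to the size of the cut. *)
Lemma cut_ge_card (S : {set T}) : #|S|.*2 <= 3 ^ n -> #|S| <= #|edge_cut (@cube3_adj n) S|.
Proof.
move=> halfS; have [->|S0] := posnP #|S|; first by [].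
rewrite -(@leq_exp2l 3) //.
have := cut_isoperimetry S; set c := 3 ^ #|edge_cut _ _|; set s := #|S|.
have : (s.*2 ^ s) ^ 2 <= (3 ^ n) ^ (2 * s).
  by rewrite mulnC expnM; apply: leq_expnl; apply: leq_expnl.
move=> h1 h2; have := leq_trans h1 h2.
rewrite -mul2n expnMn expnMn leq_pmul2r ?expn_gt0 ?S0 //.
apply: leq_trans; rewrite -expnM mulnC expnM; exact: leq_expnl.
Qed.

End CubeGraph.

(** * Isolated vertices *)

Lemma alternating_binomial_sum (R : numDomainType) k m :
  \sum_(j < m.+1) (-1) ^+ j * 'C(k.+1, j)%:R = (-1) ^+ m * 'C(k, m)%:R :> R.
Proof.
elim: m => [|m IH]; first by rewrite big_ord_recl big_ord0 /= addr0 !bin0.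
by rewrite big_ord_recr IH binS natrD exprS /=; ring.
Qed.

(** Pointwise Bonferroni: for positive [k] and [m] the truncated sum is, up to sign,
    ['C(k - 1, m - 1)], a summand of ['C(k, m)] in Pascal's rule. *)
Lemma bonferroni_binomial (R : numDomainType) k m :
  `|(k == 0%N)%:R - \sum_(j < m) (-1) ^+ j * 'C(k, j)%:R| <= 'C(k, m)%:R :> R.
Proof.
case: m => [|m]; first by rewrite big_ord0 subr0 bin0; case: eqP; rewrite ?normr1 ?normr0.
case: k => [|k].
  rewrite big_ord_recl big1 ?addr0 /=; last by move=> i _; rewrite bin0n mulr0.
  by rewrite expr0 mul1r subrr normr0.
rewrite alternating_binomial_sum sub0r normrN normrM normrX normrN1 expr1n mul1r.
by rewrite normr_nat binS ler_nat leq_addl.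
Qed.

Section Isolated.
Variables (T : finType) (R : realFieldType) (a : rel T) (d : nat) (p : R).
Hypotheses (p_ge0 : 0 <= p) (p_lt1 : p < 1).
Hypotheses (a_sym : symmetric a) (a_irr : irreflexive a).
Hypothesis (a_deg : forall x, (#|[set y | a x y]| = d)%N).
Local Notation E := (edge_set a).
Local Notation P := (subgraph_prob E p).
Local Notation w := (subgraph_weight E p).
Local Notation q := (1 - p).
Local Notation N := #|T|.
Local Notation isolated H := [set x | isolated_vertex H x].

(** The mean of ['C(X, j)] for the number [X] of isolated vertices, that is, its [j]-th factorial
    moment over [j!]: all of [B] is isolated exactly when every edge touching [B] is absent. *)
Definition isolated_moment j : R :=
  \sum_(B : {set T} | #|B| == j) q ^+ #|touching a B|.

Let p_le1 : p <= 1. Proof. exact: ltW. Qed.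
Let q_gt0 : 0 < q. Proof. by rewrite subr_gt0. Qed.
Let q_le1 : q <= 1. Proof. by rewrite lerBlDr lerDl. Qed.

Lemma isolated_momentE j :
  isolated_moment j = \sum_(H in powerset E) w H * 'C(#|isolated H|, j)%:R.
Proof.
transitivity (\sum_(B : {set T}) P (fun H => (#|B| == j) && (B \subset isolated H))).
  rewrite /isolated_moment big_mkcond /=; apply: eq_bigr => B _.
  case: eqP => [cB|_] /=; last by rewrite subgraph_probE big1 // => H _; exact: mulr0.
  rewrite -(subgraph_prob_disjoint p_ge0 p_le1 (touching_sub a B)).
  by apply: eq_subgraph_prob => // H sHE; rewrite (isolated_touching_set _ sHE).
rewrite subgraph_prob_expect; apply: eq_bigr => H _.
rewrite -cards_draws; congr (_ * _%:R); apply: eq_card => B.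
by rewrite !inE andbC.
Qed.

Lemma no_isolatedE (H : {set {set T}}) : no_isolated H = (#|isolated H| == 0)%N.
Proof.
rewrite cards_eq0; apply/forallP/eqP => [noi|/setP iso0 x].
  by apply/setP => x; rewrite !inE (negbTE (noi x)).
by have := iso0 x; rewrite !inE => ->.
Qed.

Lemma bonferroni_no_isolated m :
  `|P (@no_isolated T) - \sum_(j < m) (-1) ^+ j * isolated_moment j|
    <= isolated_moment m.
Proof.
rewrite subgraph_probE isolated_momentE.
under [X in _ - X]eq_bigr do rewrite isolated_momentE mulr_sumr.
rewrite exchange_big -sumrB /=.
apply: le_trans (ler_norm_sum _ _ _) _; apply: ler_sum => H _.
under eq_bigr do rewrite mulrCA.
rewrite -mulr_sumr -mulrBr normrM ger0_norm ?subgraph_weight_ge0 //.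
apply: ler_wpM2l; first exact: subgraph_weight_ge0.
by rewrite no_isolatedE bonferroni_binomial.
Qed.

Lemma isolated_moment0 : isolated_moment 0 = 1.
Proof.
rewrite /isolated_moment (big_pred1 set0) ?touching0 ?cards0 // => B.
exact: cards_eq0.
Qed.

(** Double counting of the sets of [j + 1] vertices with a marked element [x]. *)
Lemma isolated_momentS j : j.+1%:R * isolated_moment j.+1 =
  \sum_(B : {set T} | #|B| == j) \sum_(x in ~: B) q ^+ #|touching a (x |: B)|.
Proof.
transitivity (\sum_(x : T) \sum_(B : {set T} | (#|B| == j.+1) && (x \in B))
    q ^+ #|touching a B|).
  rewrite (exchange_big_dep (fun B : {set T} => #|B| == j.+1)) /=; last first.
    by move=> x B _ /andP[].
  rewrite /isolated_moment mulr_sumr; apply: eq_bigr => B cB.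
  rewrite (eq_bigl (mem B)) => [|x]; last by rewrite cB.
  by rewrite sumr_const (eqP cB) mulr_natl.
rewrite [RHS](exchange_big_dep xpredT) //=; apply: eq_bigr => x _.
rewrite (reindex_onto (fun B => x |: B) (fun B => B :\ x)) /=; last first.
  by move=> B /andP[_ xB]; rewrite setD1K.
apply: eq_bigl => B; rewrite setU11 andbT inE.
have [xB|xB] := boolP (x \in B).
  by rewrite andbF; apply/negbTE; rewrite negb_and; apply/orP; right;
    apply/eqP => eq; move: xB; rewrite -eq !inE eqxx.
by rewrite setU1K // eqxx !andbT cardsU1 xB add1n eqSS.
Qed.

(** Each of the [N - j] vertices outside [B] brings in at most [d] new edges. *)
Lemma isolated_moment_ge j :
  q ^+ d * (N%:R - j%:R) * isolated_moment j <= j.+1%:R * isolated_moment j.+1.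
Proof.
rewrite isolated_momentS {1}/isolated_moment mulr_sumr; apply: ler_sum => B cB.
have cBC : N%:R - j%:R = #|~: B|%:R :> R.
  by rewrite -(cardsC B) (eqP cB) natrD addrC addKr.
rewrite cBC mulrAC mulr_natr -sumr_const; apply: ler_sum => x.
rewrite inE => xB; rewrite -exprD ler_wiXn2l ?(ltW q_gt0) //.
have := card_touchingU1 a_sym a_irr a_deg xB; lia.
Qed.

(** A vertex with [k] neighbours in [B] brings in [d - k] new edges. As [k <= j], the excess factor
    [q ^ (- k)] is at most [1 + k / q ^ j], and the numbers [k] add up to at most [d j] over all
    vertices. *)
Lemma isolated_moment_le j :
  j.+1%:R * isolated_moment j.+1 <=
    q ^+ d * (N%:R + d%:R * j%:R / q ^+ j) * isolated_moment j.
Proof.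
rewrite isolated_momentS /isolated_moment mulr_sumr; apply: ler_sum => B cB.
pose degB x := #|[set y in B | a x y]|.
apply: (@le_trans _ _ (\sum_(x : T) q ^+ d * q ^+ #|touching a B| *
    (1 + (degB x)%:R / q ^+ j))).
  rewrite big_mkcond /=; apply: ler_sum => x _; case: ifP => [|_]; last first.
    by rewrite !mulr_ge0 ?addr_ge0 ?mulr_ge0 ?invr_ge0 ?exprn_ge0 // ltW.
  rewrite inE => xB; have := card_touchingU1 a_sym a_irr a_deg xB.
  rewrite -/(degB x) => tE.
  rewrite -(@ler_pM2r _ (q ^+ degB x)) ?exprn_gt0 // -[leLHS]exprD tE addnC exprD.
  rewrite -[leRHS]mulrA ler_peMr ?mulr_ge0 ?exprn_ge0 ?(ltW q_gt0) //.
  have [->|deg0] := posnP (degB x); first by rewrite mul0r addr0 mulr1.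
  have degj : (degB x <= j)%N.
    rewrite -(eqP cB); apply/subset_leq_card/subsetP => y.
    by rewrite inE => /andP[].
  apply: (@le_trans _ _ ((degB x)%:R / q ^+ j * q ^+ degB x)).
    rewrite -mulrA mulr_ege1 ?ler1n // mulrC ler_pdivlMr ?exprn_gt0 // mul1r.
    by rewrite ler_wiXn2l // (ltW q_gt0).
  by rewrite ler_pM2r ?exprn_gt0 // lerDr ler01.
rewrite -mulr_sumr big_split /= sumr_const -mulr_suml [leRHS]mulrAC.
apply: ler_wpM2l; first by rewrite mulr_ge0 ?exprn_ge0 // ltW.
rewrite lerD2l ler_wpM2r ?invr_ge0 ?exprn_ge0 ?(ltW q_gt0) // -natr_sum -natrM ler_nat.
rewrite /degB.
under eq_bigr do rewrite -sum1_card.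
rewrite (exchange_big_dep (mem B)) /=; last by move=> x y _; rewrite inE => /andP[].
rewrite mulnC -(eqP cB) -sum_nat_const; apply: leq_sum => y yB.
rewrite -(a_deg y) -sum1_card leq_eqVlt; apply/orP; left; apply/eqP.
by apply: eq_bigl => x; rewrite !inE yB a_sym.
Qed.

Lemma isolated_moment1 : isolated_moment 1 = N%:R * q ^+ d.
Proof.
apply/le_anti; have := isolated_moment_ge 0; have := isolated_moment_le 0.
rewrite isolated_moment0 !mulr0 mul0r addr0 subr0 !mulr1 mul1r mulrC => -> ->.
by [].
Qed.

(* Chebyshev: on the event that there is no isolated vertex,
   [(X - lam) ^ 2 = lam ^ 2] for the number [X] of isolated vertices. *)
Lemma second_moment_no_isolated (lam := N%:R * q ^+ d) :
  P (@no_isolated T) * lam ^+ 2 <= lam + lam ^+ 2 * (d%:R / (q * N%:R)).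
Proof.
have [N0|N0] := posnP N.
  by rewrite /lam N0 !mul0r expr0n /= !mulr0 mul0r addr0.
have lam0 : 0 <= lam by rewrite mulr_ge0 ?exprn_ge0 ?(ltW q_gt0).
have S2 : 2%:R * isolated_moment 2 <= lam ^+ 2 + lam ^+ 2 * (d%:R / (q * N%:R)).
  apply: le_trans (isolated_moment_le 1) _.
  rewrite isolated_moment1 -/lam expr1 mulr1 le_eqVlt; apply/orP; left; apply/eqP.
  have Nn0 : N%:R != 0 :> R by rewrite pnatr_eq0 -lt0n.
  have qn0 : q != 0 by rewrite gt_eqF.
  by rewrite /lam; field; rewrite ?Nn0 ?qn0.
suff : P (@no_isolated T) * lam ^+ 2 <=
    2%:R * isolated_moment 2 + lam - 2 * lam * lam + lam ^+ 2.
  move=> /le_trans; apply; lra.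
(* [(X - lam) ^ 2] is written with binomial coefficients, whose means are the isolated moments. *)
apply: (@le_trans _ _ (\sum_(H in powerset E) w H *
    (2 * 'C(#|isolated H|, 2)%:R + #|isolated H|%:R - 2 * lam * #|isolated H|%:R + lam ^+ 2))).
  rewrite subgraph_probE mulr_suml; apply: ler_sum => H _; rewrite -mulrA.
  apply: ler_wpM2l; first exact: subgraph_weight_ge0.
  rewrite no_isolatedE; set X := #|isolated H|.
  have -> : 2 * 'C(X, 2)%:R = X%:R * (X%:R - 1) :> R.
    rewrite -natrM -mul_bin_diag bin1; case: X => [|X]; first by rewrite !mul0r.
    by rewrite natrM -[X.+1%:R]natr1 addrK.
  case: eqP => [->|_]; first by rewrite mul1r; lra.
  rewrite mul0r; have := sqr_ge0 (X%:R - lam); lra.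
pose X (H : {set {set T}}) := #|isolated H|.
rewrite (eq_bigr (fun H => 2 * (w H * 'C(X H, 2)%:R) + w H * 'C(X H, 1)%:R
    - 2 * lam * (w H * 'C(X H, 1)%:R) + lam ^+ 2 * (w H * 1))); last first.
  by move=> H _; rewrite bin1 /X; ring.
rewrite !(big_split, sumrN) /= -!mulr_sumr -!isolated_momentE isolated_moment1 -/lam.
have <- : P xpredT = \sum_(H in powerset E) w H * 1 by rewrite subgraph_probE.
by rewrite subgraph_probT // mulr1.
Qed.

End Isolated.

(** * Large components *)

Section Connectivity.
Variables (R : realFieldType) (n : nat) (p : R).
Hypotheses (p_gt0 : 0 < p) (p_lt1 : p < 1) (p_large : 3 * (1 - p) ^+ 2 <= 1).
Hypothesis (n_gt0 : (0 < n)%N).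
Local Notation T := 'I_(3 ^ n).
Local Notation adj := (@cube3_adj n).
Local Notation E := (cube3_edges n).
Local Notation P := (subgraph_prob E p).
Local Notation q := (1 - p).
Local Notation N := (3 ^ n)%N.
Implicit Types (H : {set {set T}}) (S A : {set T}).

Let p_ge0 : 0 <= p. Proof. exact: ltW. Qed.
Let p_le1 : p <= 1. Proof. exact: ltW. Qed.
Let q_gt0 : 0 < q. Proof. by rewrite subr_gt0. Qed.
Let q_ge0 : 0 <= q. Proof. exact: ltW. Qed.
Let q_le1 : q <= 1. Proof. by rewrite lerBlDr lerDl. Qed.
Let N_gt0 : 0 < N%:R :> R. Proof. by rewrite ltr0n expn_gt0. Qed.

(** After squaring, isoperimetry turns [N ^ (2 s)] into [3 ^ c * s ^ (2 s)] for a cut of [c] edges,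
    and [3 ^ c] is cancelled by [q ^ (2 c)] because [3 q ^ 2 <= 1]. *)
Lemma prob_cut_le S : q ^+ #|edge_cut adj S| <= (#|S|%:R / N%:R) ^+ #|S|.
Proof.
set c := #|edge_cut _ _|; set s := #|S|.
rewrite expr_div_n ler_pdivlMr ?exprn_gt0 //.
rewrite -(@ler_pXn2r _ 2) ?nnegrE ?mulr_ge0 ?exprn_ge0 ?ler0n //.
have iso : N%:R ^+ (2 * s) <= 3 ^+ c * (s%:R ^+ s) ^+ 2 :> R.
  by rewrite -!natrX -natrM ler_nat; exact: cut_isoperimetry.
rewrite exprMn -[(N%:R ^+ s) ^+ 2]exprM [(s * 2)%N]mulnC.
apply: le_trans (ler_wpM2l _ iso) _; first by rewrite !exprn_ge0.
rewrite mulrA ler_piMl ?exprn_ge0 ?ler0n //.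
by rewrite -exprM mulnC exprM -exprMn mulrC exprn_ile1 ?mulr_ge0 ?exprn_ge0.
Qed.

(** The two boundary edges lost per vertex cost a factor [q ^ (-2)] for each vertex. *)
Lemma prob_cut_codir_le i S :
  q ^+ #|edge_cut (codir_adj i) S| <= (#|S|%:R / (N%:R * q ^+ 2)) ^+ #|S|.
Proof.
rewrite invfM mulrA exprMn exprVn -exprM ler_pdivlMr ?exprn_gt0 //.
apply: le_trans (prob_cut_le S); rewrite -exprD ler_wiXn2l //.
exact: card_cut_codir.
Qed.

Lemma prob_component_eq x s :
  P (fun H => #|component H x| == s) <=
    ((2 * n) ^ (s.-1).*2)%:R * (s%:R / N%:R) ^+ s.
Proof.
rewrite -(@eq_subgraph_prob _ _ _ _ p_ge0 p_le1
  (fun H => #|component (H :&: edge_set adj) x| == s)); last first.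
  by move=> H sHE; rewrite (setIidPl _).
apply: prob_component_card => //.
- exact: cube3_adj_sym.
- by move=> y; rewrite cube3_adj_deg.
- by move=> S <-; exact: prob_cut_le.
Qed.

Lemma prob_component_codir_eq i x s :
  P (fun H => #|component (H :&: edge_set (codir_adj i)) x| == s) <=
    ((2 * n) ^ (s.-1).*2)%:R * (s%:R / (N%:R * q ^+ 2)) ^+ s.
Proof.
apply: prob_component_card => //.
- exact: codir_adj_sym.
- exact: codir_adj_sub.
- exact: codir_adj_deg.
- by rewrite exprn_ge0 // divr_ge0 // mulr_ge0 // exprn_ge0.
- by move=> S <-; exact: prob_cut_codir_le.
Qed.

(** [A] is a union of components of [H] without its edges in direction [i], in the boolean form
    counted by [card_closed_sets]. *)
Definition dir_closed i H A :=
  [forall x, [forall y, edge_rel (H :&: edge_set (codir_adj i)) x y ==>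
    ((x \in A) == (y \in A))]].

(** Take a component filling at most half of the cube. If it has at least [M] vertices, so many
    edges bound it, and by pigeonhole some direction carries at least [M / n] of them. *)
Lemma disconnected_cases M H : (0 < M)%N -> H \subset E ->
  no_isolated H && ~~ connected_graph H ->
  [exists s : 'I_M, (1 < s)%N && [exists x, #|component H x| == s]] ||
  [exists i, [exists A, (M <= n * #|edge_cut (dir_adj i) A|)%N &&
    ([disjoint H & edge_cut (dir_adj i) A] && dir_closed i H A)]].
Proof.
move=> M0 sHE /andP[noi /half_component[x hx]].
have cx1 : (1 < #|component H x|)%N.
  apply: component_gt1 => // f /(subsetP sHE) /edge_setP[y [z [yz ->]]].
  rewrite cards2; case: eqVneq => // eq; move: yz; rewrite eq.
  by rewrite cube3_adj_irr.
have [ltM|leM] := ltnP #|component H x| M.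
  apply/orP; left; apply/existsP; exists (Ordinal ltM); rewrite /= cx1.
  by apply/existsP; exists x.
apply/orP; right; set A := component H x in hx cx1 leM.
have clA : closed (edge_rel H) (mem A) by exact: closed_component.
have [/existsP[i cutM]|] := boolP [exists i, (M <= n * #|edge_cut (dir_adj i) A|)%N].
  apply/existsP; exists i; apply/existsP; exists A; rewrite cutM /=.
  apply/andP; split.
    apply: disjointWr (closed_disjoint_cut adj clA).
    apply/subsetP => e /imsetP[z]; rewrite inE => /and3P[z1 z2 /dir_adj_sub z12] ->.
    by apply: imset_f; rewrite inE z1 z2.
  apply/forallP => y; apply/forallP => z; apply/implyP.
  by rewrite /edge_rel inE => /andP[/clA /= -> _].
(* If every direction stayed below [M / n], the whole cut would have at most [M - 1] edges. *)
rewrite negb_exists => /forallP small.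
have : (\sum_i (n * #|edge_cut (dir_adj i) A|) <= \sum_(i < n) M.-1)%N.
  by apply: leq_sum => i _; rewrite -ltnS prednK // ltnNge; exact: small.
rewrite -big_distrr /= card_cut_dir sum_nat_const card_ord leq_pmul2l //.
have := @cut_ge_card n A; rewrite card_ord in hx; move/(_ hx) => le_cut le_M.
by have := leq_trans leM (leq_trans le_cut le_M); rewrite -ltnS prednK // ltnn.
Qed.

Lemma prob_small_component M :
  P (fun H => [exists s : 'I_M, (1 < s)%N && [exists x, #|component H x| == s]]) <=
    \sum_(s < M | (1 < s)%N) N%:R * (4 * n%:R ^+ 2 * s%:R / N%:R) ^+ s.
Proof.
apply: le_trans (subgraph_prob_ex _ p_ge0 p_le1
  (fun s : 'I_M => (1 < s)%N) (fun s H => [exists x, #|component H x| == s])) _.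
apply: ler_sum => s s1.
apply: le_trans (subgraph_prob_ex _ p_ge0 p_le1
  xpredT (fun x H => #|component H x| == s)) _.
apply: (@le_trans _ _ (\sum_(x : T) (4 * n%:R ^+ 2 * s%:R / N%:R) ^+ s)); last first.
  by rewrite sumr_const card_ord [leRHS]mulr_natl.
apply: ler_sum => x _; apply: le_trans (prob_component_eq x s) _.
(* The walk length [2 (s - 1)] is relaxed to [2 s], so that the number of walks enters the [s]-th
   power. *)
rewrite -[_ * _ / _]mulrA [leRHS]exprMn; apply: ler_wpM2r.
  by rewrite exprn_ge0 // divr_ge0.
have -> : 4 * n%:R ^+ 2 = ((2 * n) ^ 2)%:R :> R by rewrite natrX natrM; ring.
by rewrite -natrX -expnM ler_nat leq_pexp2l ?muln_gt0 // mul2n leq_double leq_pred.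
Qed.

Lemma mem_cut_dir_codir i A e : e \in edge_cut (dir_adj i) A ->
  e \notin edge_set (codir_adj i).
Proof.
move=> /imsetP[[x y]]; rewrite inE /= => /and3P[_ _ /andP[_ xy]] ->.
by rewrite mem_edge_set ?/codir_adj ?(negbTE xy) ?andbF //; exact: codir_adj_sym.
Qed.

(* The retained edges in direction [i] are independent of those in the other
   directions, which have at most [2 ^ K] unions of components. *)
Lemma prob_dir_cut i K L :
  P (fun H => [exists A, (L <= #|edge_cut (dir_adj i) A|)%N &&
    ([disjoint H & edge_cut (dir_adj i) A] && (dir_closed i H A &&
      (#|components (H :&: edge_set (codir_adj i))| <= K)%N))]) <=
    (2 ^ K)%:R * q ^+ L.
Proof.
pose F A H := dir_closed i H A && (#|components (H :&: edge_set (codir_adj i))| <= K)%N.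
apply: le_trans (subgraph_prob_ex _ p_ge0 p_le1
  (fun A => (L <= #|edge_cut (dir_adj i) A|)%N)
  (fun A H => [disjoint H & edge_cut (dir_adj i) A] && F A H)) _.
apply: (@le_trans _ _ (\sum_A P (F A) * q ^+ L)).
  rewrite big_mkcond /=; apply: ler_sum => A _; case: ifP => [LA|_]; last first.
    by rewrite mulr_ge0 ?exprn_ge0 ?subgraph_prob_ge0.
  rewrite subgraph_prob_absent //.
  - rewrite mulrC; apply: ler_wpM2l; first exact: subgraph_prob_ge0.
    exact: ler_wiXn2l.
  - apply/subsetP => e /imsetP[z]; rewrite inE => /and3P[_ _ /dir_adj_sub z12] ->.
    by rewrite mem_edge_set //; exact: cube3_adj_sym.
  - move=> e H /mem_cut_dir_codir eC.
    have eqH : (H :\ e) :&: edge_set (codir_adj i) = H :&: edge_set (codir_adj i).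
      apply/setP => f; rewrite !in_setI in_setD1; case: (eqVneq f e) => [->|//].
      by rewrite (negbTE eC) !andbF.
    by rewrite /F /dir_closed eqH.
rewrite -mulr_suml; apply: ler_wpM2r; first exact: exprn_ge0.
rewrite subgraph_prob_expect.
apply: (@le_trans _ _ (\sum_(H in powerset E) subgraph_weight E p H * (2 ^ K)%:R)).
  apply: ler_sum => H _; apply: ler_wpM2l; first exact: subgraph_weight_ge0.
  rewrite ler_nat; have [leK|gtK] := leqP #|components (H :&: edge_set (codir_adj i))| K.
    apply: leq_trans (leq_trans (card_closed_sets (H :&: edge_set (codir_adj i))) _).
      by apply/subset_leq_card/subsetP => A; rewrite !inE => /andP[].
    by rewrite leq_exp2l.
  rewrite (_ : [set A | F A H] = set0) ?cards0 //.
  by apply/setP => A; rewrite !inE /F leqNgt gtK andbF.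
rewrite -mulr_suml -[leRHS]mul1r; apply: ler_wpM2r; first exact: ler0n.
rewrite -(subgraph_probT E p_ge0 p_le1) subgraph_probE.
by under [leRHS]eq_bigr do rewrite mulr1.
Qed.

(** At most [N / m <= K / 2] components have [m] vertices or more, so an excess over [K] forces at
    least [K / 2] vertices into smaller components; Markov's inequality bounds this. *)
Lemma prob_many_components i K m : (0 < m)%N -> ((N %/ m).*2 <= K)%N ->
  P (fun H => (K < #|components (H :&: edge_set (codir_adj i))|)%N) * (K%:R / 2) <=
    N%:R * \sum_(s < m | (0 < s)%N)
      (4 * n%:R ^+ 2 * s%:R / (N%:R * q ^+ 2)) ^+ s.
Proof.
move=> m0 leK.
pose A x H := (#|component (H :&: edge_set (codir_adj i)) x| < m)%N.
apply: (@le_trans _ _ (P (fun H => K%:R / 2 <= #|[set x | A x H]|%:R :> R) * (K%:R / 2))).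
  apply: ler_wpM2r; first by rewrite divr_ge0.
  apply: subgraph_prob_le => // H _ ltK.
  have := card_components (H :&: edge_set (codir_adj i)) m0.
  rewrite card_ord -/(A^~ H) => le.
  rewrite /= ler_pdivrMr // -natrM ler_nat.
  move: le ltK leK; move: #|[set x | _]| #|components _| (N %/ m)%N => u c v.
  by clear; lia.
apply: le_trans (subgraph_prob_markov _ p_ge0 p_le1 A (K%:R / 2)) _.
apply: (@le_trans _ _ (\sum_(x : T) \sum_(s < m | (0 < s)%N)
    (4 * n%:R ^+ 2 * s%:R / (N%:R * q ^+ 2)) ^+ s)); last first.
  by rewrite sumr_const card_ord [leRHS]mulr_natl.
apply: ler_sum => x _.
apply: (@le_trans _ _ (\sum_(s < m | (0 < s)%N)
   P (fun H => #|component (H :&: edge_set (codir_adj i)) x| == s))).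
  apply: le_trans (subgraph_prob_ex _ p_ge0 p_le1 (fun s : 'I_m => (0 < s)%N) _).
  apply: subgraph_prob_le => // H _ lt; apply/existsP; exists (Ordinal lt).
  rewrite /= eqxx andbT; apply/card_gt0P; exists x; exact: component_refl.
apply: ler_sum => s s0; apply: le_trans (prob_component_codir_eq i x s) _.
rewrite -[_ * _ / _]mulrA [leRHS]exprMn; apply: ler_wpM2r.
  by rewrite exprn_ge0 // divr_ge0 // mulr_ge0 // exprn_ge0.
have -> : 4 * n%:R ^+ 2 = ((2 * n) ^ 2)%:R :> R by rewrite natrX natrM; ring.
by rewrite -natrX -expnM ler_nat leq_pexp2l ?muln_gt0 // mul2n leq_double leq_pred.
Qed.

(** [M] separates small components from large ones, [L] is the size of the cut of a large one in
    some direction [i], [K] caps the number of components without direction [i], and [m] is the size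
    below which these are small. The terms stand for a small component, an absent cut under the cap,
    and an exceeded cap. *)
Lemma prob_disconnected_le M L K m :
  (0 < M)%N -> (L * n <= M)%N -> (0 < m)%N -> ((N %/ m).*2 <= K)%N -> (0 < K)%N ->
  P (fun H => no_isolated H && ~~ connected_graph H) <=
    \sum_(s < M | (1 < s)%N) N%:R * (4 * n%:R ^+ 2 * s%:R / N%:R) ^+ s +
    n%:R * ((2 ^ K)%:R * q ^+ L +
      2 / K%:R * (N%:R * \sum_(s < m | (0 < s)%N)
        (4 * n%:R ^+ 2 * s%:R / (N%:R * q ^+ 2)) ^+ s)).
Proof.
move=> M0 LM m0 mK K0.
pose A H := [exists s : 'I_M, (1 < s)%N && [exists x, #|component H x| == s]].
pose B i H := [exists A, (M <= n * #|edge_cut (dir_adj i) A|)%N &&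
    ([disjoint H & edge_cut (dir_adj i) A] && dir_closed i H A)].
apply: (@le_trans _ _ (P (fun H => A H || [exists i, B i H]))).
  by apply: subgraph_prob_le => // H; exact: disconnected_cases.
apply: le_trans (subgraph_probU _ p_ge0 p_le1 _ _) _.
apply: lerD; first exact: prob_small_component.
apply: le_trans (subgraph_prob_ex _ p_ge0 p_le1 xpredT B) _.
set Y := (X in n%:R * X).
rewrite (_ : n%:R * Y = \sum_(i < n) Y); last first.
  by rewrite sumr_const card_ord mulr_natl.
apply: ler_sum => i _; rewrite /Y.
rewrite (subgraph_probID E p
  (fun H => (#|components (H :&: edge_set (codir_adj i))| <= K)%N)).
apply: lerD.
  apply: le_trans (prob_dir_cut i K L); apply: subgraph_prob_le => // H _.
  move=> /andP[leK /existsP[S /and3P[MA HA clA]]]; apply/existsP; exists S.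
  rewrite HA clA leK !andbT.
  by rewrite -(@leq_pmul2l n) // mulnC; apply: leq_trans MA.
rewrite -ler_pdivrMl ?divr_gt0 ?ltr0n // invf_div mulrC.
apply: le_trans (prob_many_components i m0 mK); apply: ler_wpM2r.
  by rewrite divr_ge0.
by apply: subgraph_prob_le => // H _ /andP[]; rewrite -ltnNge.
Qed.

End Connectivity.

(** * Choice of the cut-offs and an explicit bound *)

Section ConnectivityBound.
Variables (R : realFieldType) (n : nat) (p : R).
Hypotheses (p_gt0 : 0 < p) (p_lt1 : p < 1) (p_large : 3 * (1 - p) ^+ 2 <= 1).
Local Notation q := (1 - p).
Hypotheses (n_large : (324 <= n)%N).
Hypothesis (N_large : 4 * n%:R ^+ 8 <= (3 ^ n)%:R * q ^+ 2).
Local Notation N := (3 ^ n)%N.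

Let q_gt0 : 0 < q. Proof. by rewrite subr_gt0. Qed.
Let q_ge0 : 0 <= q. Proof. exact: ltW. Qed.
Let q_le1 : q <= 1. Proof. by rewrite lerBlDr lerDl ltW. Qed.
Let N_gt0 : 0 < N%:R :> R. Proof. by rewrite ltr0n expn_gt0. Qed.
Let n_gt0 : (0 < n)%N. Proof. exact: leq_trans n_large. Qed.
Let x_gt0 : 0 < n%:R :> R. Proof. by rewrite ltr0n. Qed.
Let x_ge1 : 1 <= n%:R :> R. Proof. by rewrite ler1n. Qed.

Let N_large_nat : (4 * n ^ 8 <= N)%N.
Proof.
rewrite -(@ler_nat R) natrM natrX; apply: le_trans N_large _.
by rewrite ler_piMr ?(ltW N_gt0) // exprn_ile1.
Qed.

Let leq_powN k : (k <= 8)%N -> (n ^ k <= N)%N.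
Proof.
move=> k8; apply: leq_trans (leq_trans (leq_pexp2l n_gt0 k8) _) N_large_nat.
by rewrite leq_pmull.
Qed.

Let div_gt0 k : (k <= 8)%N -> (0 < N %/ n ^ k)%N.
Proof. by move=> k8; rewrite divn_gt0 ?expn_gt0 ?n_gt0 ?leq_powN. Qed.

(** For [s <= n] the ratio is at most [4 n ^ 3 / N <= 1], and its square gives [A]; there are at
    most [n + 1 <= 2 n] such [s], whence [32]. For [s > n] the ratio is at most [1 / 81], and [N]
    copies of [B = N / 81 ^ n] add at most one more [n ^ 7 / N]. *)
Lemma small_component_bound :
  \sum_(s < N %/ n ^ 3 | (1 < s)%N) N%:R * (4 * n%:R ^+ 2 * s%:R / N%:R) ^+ s
    <= 33 * n%:R ^+ 7 / N%:R :> R.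
Proof.
set M := (N %/ n ^ 3)%N.
pose A : R := 16 * n%:R ^+ 6 / N%:R; pose B : R := N%:R * 81^-1 ^+ n.
have A0 : 0 <= A by rewrite divr_ge0 ?mulr_ge0 ?exprn_ge0 // ltW.
have B0 : 0 <= B by rewrite mulr_ge0 ?exprn_ge0 // ltW.
have term (s : 'I_M) : (1 < s)%N ->
    N%:R * (4 * n%:R ^+ 2 * s%:R / N%:R) ^+ s <= A * (s <= n)%:R + B.
  move=> s1; set y := _ / _.
  have y0 : 0 <= y by rewrite divr_ge0 ?mulr_ge0 ?exprn_ge0 // ltW.
  have [sn|ns] := leqP s n.
    rewrite mulr1 -[leLHS]addr0 lerD //.
    have y1 : y <= 4 * n%:R ^+ 3 / N%:R.
      rewrite ler_wpM2r ?invr_ge0 ?(ltW N_gt0) // (exprSr _ 2) mulrA.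
      by rewrite ler_wpM2l ?mulr_ge0 ?exprn_ge0 // ler_nat.
    have y2 : y <= 1.
      apply: le_trans y1 _; rewrite ler_pdivrMr // mul1r -natrX -natrM ler_nat.
      by apply: leq_trans N_large_nat; rewrite leq_mul2l /= leq_pexp2l.
    have -> : A = N%:R * (4 * n%:R ^+ 3 / N%:R) ^+ 2.
      by rewrite /A; field; rewrite gt_eqF.
    rewrite ler_wpM2l ?(ltW N_gt0) //; apply: (@le_trans _ _ (y ^+ 2)).
      exact: ler_wiXn2l.
    by rewrite ler_pXn2r ?nnegrE // (le_trans y0).
  rewrite mulr0 add0r /B ler_wpM2l ?(ltW N_gt0) //.
  have y81 : y <= 81^-1.
    rewrite /y ler_pdivrMr // [leRHS]mulrC ler_pdivlMr //.
    have := leq_trunc_div N (n ^ 3); rewrite -/M => leN.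
    have : (s * n ^ 3 <= N)%N by apply: leq_trans leN; rewrite leq_mul2r ltnW ?orbT.
    rewrite -(@ler_nat R) natrM natrX => le_N; apply: (le_trans _ le_N).
    (* The lower bound on [n] comes from here: [s n ^ 3 <= N] makes the ratio at most [4 / n]. *)
    have -> : 4 * n%:R ^+ 2 * s%:R * 81 = s%:R * n%:R ^+ 2 * 324 :> R by ring.
    rewrite (exprSr _ 2) mulrA ler_wpM2l ?mulr_ge0 ?exprn_ge0 //.
    by rewrite (ler_nat R 324).
  apply: (@le_trans _ _ (81^-1 ^+ s)); first by apply: lerXn2r; rewrite ?nnegrE ?invr_ge0.
  by apply: ler_wiXn2l; [lra|lra|exact: ltnW].
apply: (@le_trans _ _ (\sum_(s < M) (A * (s <= n)%:R + B))).
  rewrite big_mkcond /=; apply: ler_sum => s _; case: ifP => [/term //|_].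
  by rewrite addr_ge0 ?mulr_ge0.
rewrite big_split /= -mulr_sumr sumr_const card_ord -natr_sum.
have cnt : (\sum_(s < M) (s <= n) <= 2 * n)%N.
  apply: (@leq_trans n.+1); last by rewrite mul2n -addnn -addn1 leq_add2l.
  have -> : (\sum_(s < M) (s <= n) = #|[set s : 'I_M | s <= n]|)%N.
    by rewrite -sum1_card [RHS]big_mkcond /=; apply: eq_bigr => s _; rewrite inE; case: leqP.
  rewrite -[leqRHS]card_ord -(@card_in_imset _ _ (fun s : 'I_M => inord s : 'I_n.+1)).
    exact: max_card.
  move=> s t; rewrite !inE => sn tn /(congr1 val); rewrite /= !inordK ?ltnS // => st.
  exact/val_inj.
have MN : (M <= N)%N by exact: leq_div.
apply: (@le_trans _ _ (A * (2 * n)%:R + B *+ N)).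
  by apply: lerD; [rewrite ler_wpM2l // ler_nat|exact: ler_wpMn2l].
have BN : B *+ N <= n%:R ^+ 7 / N%:R.
  rewrite -[B *+ N]mulr_natr /B ler_pdivlMr //.
  have -> : N%:R * 81^-1 ^+ n * N%:R * N%:R = 3^-1 ^+ n :> R.
    by rewrite natrX -!exprMn; congr (_ ^+ _); field.
  apply: (@le_trans _ _ 1); last exact: exprn_ege1.
  by apply: exprn_ile1; lra.
apply: le_trans (lerD (lexx _) BN) _; rewrite /A natrM le_eqVlt; apply/orP; left.
by apply/eqP; field; rewrite gt_eqF.
Qed.

(** As [n K <= L] and [2 q ^ n <= 1 / 2], the left-hand side is at most [2 ^ (- K)]; finally
    [N <= (K + 1) n ^ 5 <= 2 ^ K n ^ 5]. *)
Lemma dir_cut_bound :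
  (2 ^ (N %/ n ^ 5))%:R * q ^+ (N %/ n ^ 4) <= n%:R ^+ 5 / N%:R :> R.
Proof.
set K := (N %/ n ^ 5)%N; set L := (N %/ n ^ 4)%N.
have nKL : (n * K <= L)%N.
  rewrite /L leq_divRL ?expn_gt0 ?n_gt0 // (leq_trans _ (leq_trunc_div N (n ^ 5))) //.
  by rewrite -/K (expnS n 4); apply/eq_leq; ring.
apply: (@le_trans _ _ ((2 ^ K)%:R * q ^+ (n * K))).
  by rewrite ler_wpM2l // ler_wiXn2l.
rewrite natrX exprM -exprMn.
have q4 : q ^+ 4 <= 4^-1.
  have q2 : q ^+ 2 <= 3^-1 by rewrite -[leRHS]mul1r ler_pdivlMr // mulrC.
  have -> : q ^+ 4 = (q ^+ 2) ^+ 2 by rewrite -exprM.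
  have : (q ^+ 2) ^+ 2 <= (3^-1) ^+ 2 by rewrite ler_pXn2r ?nnegrE ?exprn_ge0 ?invr_ge0.
  by move=> /le_trans; apply; lra.
have qn : 2 * q ^+ n <= 2^-1.
  have : q ^+ n <= q ^+ 4 by apply: ler_wiXn2l => //; apply: leq_trans n_large.
  lra.
apply: (@le_trans _ _ (2^-1 ^+ K)).
  by apply: lerXn2r; rewrite ?nnegrE ?mulr_ge0 ?exprn_ge0 ?invr_ge0.
rewrite ler_pdivlMr // exprVn mulrC ler_pdivrMr ?exprn_gt0 // -!natrX -natrM ler_nat.
apply: leq_trans (ltnW (ltn_ceil N (_ : 0 < n ^ 5)%N)) _; first by rewrite expn_gt0 n_gt0.
by rewrite mulnC leq_mul2l -/K ltn_expl ?orbT.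
Qed.

(** Every term with [s > 0] is at most [b <= 1], there are at most [n ^ 6] of them, and
    [N / K <= 2 n ^ 5]. *)
Lemma many_components_bound :
  2 / (N %/ n ^ 5)%:R * (N%:R * \sum_(s < n ^ 6 | (0 < s)%N)
    (4 * n%:R ^+ 2 * s%:R / (N%:R * q ^+ 2)) ^+ s)
  <= 16 * n%:R ^+ 19 / (N%:R * q ^+ 2) :> R.
Proof.
set K := (N %/ n ^ 5)%N.
have K0 : (0 < K)%N by exact: div_gt0.
have Nq0 : 0 < N%:R * q ^+ 2 by rewrite mulr_gt0 ?exprn_gt0.
pose b : R := 4 * n%:R ^+ 8 / (N%:R * q ^+ 2).
have b1 : b <= 1 by rewrite ler_pdivrMr // mul1r.
have sumb : \sum_(s < n ^ 6 | (0 < s)%N)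
    (4 * n%:R ^+ 2 * s%:R / (N%:R * q ^+ 2)) ^+ s <= n%:R ^+ 6 * b.
  apply: (@le_trans _ _ (\sum_(s < n ^ 6) b)); last first.
    by rewrite sumr_const card_ord -[leLHS]mulr_natl natrX.
  rewrite big_mkcond /=; apply: ler_sum => s _.
  have b0 : 0 <= b by rewrite divr_ge0 ?mulr_ge0 ?exprn_ge0 // ltW.
  case: ifP => [s0|_ //]; set y := _ / _.
  have y0 : 0 <= y by rewrite divr_ge0 ?mulr_ge0 ?exprn_ge0 ?(ltW N_gt0).
  have yb : y <= b.
    rewrite ler_wpM2r ?invr_ge0 ?(ltW Nq0) //.
    have -> : n%:R ^+ 8 = n%:R ^+ 2 * (n ^ 6)%:R :> R by rewrite natrX -exprD.
    by rewrite [leRHS]mulrA ler_wpM2l ?mulr_ge0 ?exprn_ge0 // ler_nat ltnW.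
  apply: (le_trans _ yb); rewrite -[leRHS]expr1; apply: ler_wiXn2l => //.
  exact: le_trans yb b1.
have NK : N%:R <= 2 * K%:R * n%:R ^+ 5 :> R.
  rewrite -natrX -!natrM ler_nat.
  apply: leq_trans (ltnW (ltn_ceil N (_ : 0 < n ^ 5)%N)) _; first by rewrite expn_gt0 n_gt0.
  by rewrite -/K leq_mul2r mul2n -addnn -[K.+1]add1n leq_add2r K0 orbT.
apply: (@le_trans _ _ (2 / K%:R * (2 * K%:R * n%:R ^+ 5 * (n%:R ^+ 6 * b)))).
  rewrite ler_wpM2l ?divr_ge0 //; apply: ler_pM => //.
  by apply: sumr_ge0 => s _; rewrite exprn_ge0 // divr_ge0 ?mulr_ge0 ?exprn_ge0 // ltW.
rewrite le_eqVlt; apply/orP; left; apply/eqP.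
have Kn0 : K%:R != 0 :> R by rewrite pnatr_eq0 -lt0n.
have qn0 : q != 0 by rewrite gt_eqF.
have Nn0 : N%:R != 0 :> R by rewrite gt_eqF.
rewrite /b; clearbody K; field; by rewrite qn0 Nn0 Kn0.
Qed.

(** Take for [M], [L], [K] the quotients of [N] by [n ^ 3], [n ^ 4], [n ^ 5], and [m = n ^ 6]; the
    three bounds contribute [33 + 1 + 16 = 50]. *)
Lemma prob_disconnected_bound :
  subgraph_prob (cube3_edges n) p (fun H => no_isolated H && ~~ connected_graph H)
    <= 50 * n%:R ^+ 20 / (N%:R * q ^+ 2).
Proof.
have L_M : (N %/ n ^ 4 * n <= N %/ n ^ 3)%N.
  rewrite leq_divRL ?expn_gt0 ?n_gt0 // (leq_trans _ (leq_trunc_div N (n ^ 4))) //.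
  by rewrite (expnS n 3) mulnA.
have m_K : ((N %/ n ^ 6).*2 <= N %/ n ^ 5)%N.
  rewrite leq_divRL ?expn_gt0 ?n_gt0 // (leq_trans _ (leq_trunc_div N (n ^ 6))) //.
  rewrite (expnS n 5) -mul2n mulnA leq_mul2r mulnC leq_mul2l.
  by apply/orP; right; apply/orP; right; apply: leq_trans n_large.
have m0 : (0 < n ^ 6)%N by rewrite expn_gt0 n_gt0.
have := @prob_disconnected_le _ n p p_gt0 p_lt1 p_large n_gt0 _ _ _ _ 
  (div_gt0 (_ : 3 <= 8)%N) L_M m0 m_K (div_gt0 (_ : 5 <= 8)%N).
move=> /(_ isT isT) /le_trans; apply.
have Nq0 : 0 < N%:R * q ^+ 2 by rewrite mulr_gt0 ?exprn_gt0.
have weaken k : (k <= 20)%N -> n%:R ^+ k / N%:R <= n%:R ^+ 20 / (N%:R * q ^+ 2) :> R.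
  move=> k20; apply: ler_pM; rewrite ?exprn_ge0 ?invr_ge0 ?(ltW N_gt0) //.
    exact: ler_weXn2l.
  rewrite lef_pV2 ?posrE // ler_piMr ?(ltW N_gt0) //; exact: exprn_ile1.
have h1 := small_component_bound; have h2 := dir_cut_bound; have h3 := many_components_bound.
have h2' := ler_wpM2l (ltW x_gt0) h2; have h3' := ler_wpM2l (ltW x_gt0) h3.
have w1 := weaken 7 isT; have w2 := weaken 6 isT.
rewrite mulrDr.
apply: le_trans (lerD h1 (lerD h2' h3')) _.
have -> : n%:R * (n%:R ^+ 5 / N%:R) = n%:R ^+ 6 / N%:R :> R by rewrite mulrA -exprS.
have -> : n%:R * (16 * n%:R ^+ 19 / (N%:R * q ^+ 2)) =
    16 * (n%:R ^+ 20 / (N%:R * q ^+ 2)) :> R.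
  by rewrite (exprS _ 19); ring.
rewrite -!(mulrA _ (n%:R ^+ _) _^-1); lra.
Qed.

End ConnectivityBound.
Local Open Scope classical_set_scope.
Local Open Scope ring_scope.

(** * Limits *)

Section Limits.
Variable R : realType.

(** One term of the exponential series gives [x ^ k / k! <= expR x] at [x = n / 2], and
    [expR (1 / 2) <= 2]. *)
Lemma natr_exp_le_expn k n : n%:R ^+ k <= (k`!)%:R * 2 ^+ k * 2 ^+ n :> R.
Proof.
case: k => [|k]; first by rewrite expr0 fact0 mul1r expr0 mul1r exprn_ege1 // ler1n.
have e2 : expR (2^-1 : R) <= 2.
  have := expR_ge1Dx (- 2^-1 : R); rewrite expRN => le.
  have : 2^-1 <= (expR 2^-1)^-1 :> R by apply: le_trans le; lra.
  by rewrite lef_pV2 ?posrE ?expR_gt0.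
have x0 : 0 <= n%:R / 2 :> R by rewrite divr_ge0.
have := expR_ge1Dxn k x0; set x := n%:R / 2 => le.
have {}le : x ^+ k.+1 / (k.+1)`!%:R <= 2 ^+ n.
  apply: (@le_trans _ _ (expR x)); first by apply: le_trans le; rewrite lerDr.
  rewrite /x mulrC expRM_natr; apply: lerXn2r => //; rewrite nnegrE ?expR_ge0 //.
move: le; rewrite ler_pdivrMr ?ltr0n ?fact_gt0 // => le.
have -> : n%:R = x * 2 by rewrite /x divfK.
rewrite exprMn; apply: (@le_trans _ _ (2 ^+ n * (k.+1)`!%:R * 2 ^+ k.+1)).
  by rewrite ler_wpM2r // exprn_ge0.
by rewrite le_eqVlt; apply/orP; left; apply/eqP; ring.
Qed.

Lemma cvg_exprn_div_3exp k : n%:R ^+ k / (3 ^ n)%:R @[n --> \oo] --> (0 : R).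
Proof.
pose C : R := (k`!)%:R * 2 ^+ k.
have lim : C * (2 / 3) ^+ n @[n --> \oo] --> (0 : R).
  by apply: cvg_geometric; rewrite ger0_norm; lra.
apply: (squeeze_cvgr _ (cvg_cst 0) lim); near=> n; apply/andP; split.
  by rewrite divr_ge0 // exprn_ge0.
rewrite expr_div_n mulrA natrX ler_wpM2r ?invr_ge0 ?exprn_ge0 //.
exact: natr_exp_le_expn.
Unshelve. all: by end_near.
Qed.

(** The truncation order [m] is fixed before [n] grows: the error [S m n] then tends to [1 / m!],
    which is small, and the truncated sum tends to a partial sum of the series for [expR (-1)]. *)
Lemma cvg_bonferroni (u : R^nat) (S : nat -> R^nat) :
  (forall m n, `|u n - \sum_(j < m) (-1) ^+ j * S j n| <= S m n) ->
  (forall j, S j n @[n --> \oo] --> (j`!%:R^-1 : R)) ->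
  u n @[n --> \oo] --> (expR (-1) : R).
Proof.
move=> bonf limS; apply/cvgrPdist_le => e e0.
have limE : series (exp_coeff (-1)) m @[m --> \oo] --> (expR (-1) : R).
  exact: is_cvg_series_exp_coeff.
have limT : (m`!%:R^-1 : R) @[m --> \oo] --> (0 : R).
  (* [1 / m!] is the general term of the convergent series for [expR 1]. *)
  have := cvg_series_cvg_0 (is_cvg_series_exp_coeff (1 : R)).
  by apply: cvg_trans; apply: near_eq_cvg; near=> m; rewrite /exp_coeff /= expr1n mul1r.
have e4 : 0 < e / 4 by rewrite divr_gt0.
have [m [mE mT]] : exists m, `|expR (-1) - series (exp_coeff (-1)) m| <= e / 4 /\
    m`!%:R^-1 <= e / 4.
  have /cvgrPdist_le/(_ _ e4) nearE := limE.
  have /cvgrPdist_le/(_ _ e4) nearT := limT.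
  have [m] := @filter_ex _ _ _ _ (filterI nearE nearT).
  move=> [/= h1 h2]; exists m; split=> //.
  by move: h2; rewrite sub0r normrN ger0_norm // invr_ge0.
have limsum : \sum_(j < m) (-1) ^+ j * S j n @[n --> \oo] -->
    (series (exp_coeff (-1)) m : R).
  rewrite /series /= big_mkord; apply: cvg_big => [|j _]; first exact: add_continuous.
  by apply: cvgM (limS j); exact: cvg_cst.
have /cvgrPdist_le/(_ _ e4) nearsum := limsum.
have /cvgrPdist_le/(_ _ e4) nearS := limS m.
near=> n.
have h1 : `|series (exp_coeff (-1)) m - \sum_(j < m) (-1) ^+ j * S j n| <= e / 4.
  by near: n.
have h2 : `|m`!%:R^-1 - S m n| <= e / 4 by near: n.
have h3 := bonf m n.
move: h1 h2 h3 mE mT; rewrite !ler_norml => /andP[? ?] /andP[? ?] /andP[? ?] /andP[? ?] ?.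
by apply/andP; split; lra.
Unshelve. all: by end_near.
Qed.

End Limits.

(** * The three regimes on the cube *)

Section CubeThreshold.
Variables (R : realType) (p : R).
Hypotheses (p_gt0 : 0 < p) (p_lt1 : p < 1).
Local Notation q := (1 - p).

Let p_ge0 : 0 <= p. Proof. exact: ltW. Qed.
Let p_le1 : p <= 1. Proof. exact: ltW. Qed.
Let q_gt0 : 0 < q. Proof. by rewrite subr_gt0. Qed.

Lemma cube_degE n (x : 'I_(3 ^ n)) : #|[set y | cube3_adj x y]%SET| = (2 * n)%N.
Proof. exact: cube3_adj_deg. Qed.

Definition cube_moment j n : R := isolated_moment (@cube3_adj n) p j.

Lemma mean_isolatedE n : (3 ^ n)%:R * q ^+ (2 * n) = (3 * q ^+ 2) ^+ n.
Proof. by rewrite natrX exprM -exprMn. Qed.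

Lemma cube_moment0 n : cube_moment 0 n = 1.
Proof. exact: isolated_moment0. Qed.

Lemma cube_moment1 n : cube_moment 1 n = (3 * q ^+ 2) ^+ n.
Proof.
rewrite /cube_moment (isolated_moment1 p_ge0 p_lt1 (@cube3_adj_sym n) (@cube3_adj_irr n) (@cube_degE n)).
by rewrite card_ord mean_isolatedE.
Qed.

Lemma cube_bonferroni m n :
  `|prob_no_isolated p n - \sum_(j < m) (-1) ^+ j * cube_moment j n|
    <= cube_moment m n.
Proof.
exact: (bonferroni_no_isolated (@cube3_adj n) p_ge0 p_lt1).
Qed.

(** Connectedness implies the absence of isolated vertices once there are at least two vertices,
    which excludes [n = 0]. *)
Lemma prob_connectedE n : (0 < n)%N -> prob_no_isolated p n - prob_connected p n =
  subgraph_prob (cube3_edges n) p (fun H => no_isolated H && ~~ connected_graph H).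
Proof.
move=> n0; apply/eqP; rewrite subr_eq addrC; apply/eqP.
rewrite /prob_no_isolated (subgraph_probID _ p (@connected_graph _)).
have gt1 : (1 < #|'I_(3 ^ n)|)%N by rewrite card_ord -{1}(expn0 3) ltn_exp2l.
congr (_ + _); apply: eq_subgraph_prob => // H _; last exact: andbC.
by case: (boolP (connected_graph H)) => // /(connected_no_isolated gt1).
Qed.

Lemma cvg_prob_connected (l : R) : 3 * q ^+ 2 <= 1 ->
  prob_no_isolated p n @[n --> \oo] --> l ->
  prob_connected p n @[n --> \oo] --> l.
Proof.
move=> p_large lim.
pose B (n : nat) : R := 50 / q ^+ 2 * (n%:R ^+ 20 / (3 ^ n)%:R).
have limB : B n @[n --> \oo] --> (0 : R).
  by rewrite -(mulr0 (50 / q ^+ 2)); apply: cvgM; [exact: cvg_cst|exact: cvg_exprn_div_3exp].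
have lim8 := @cvg_exprn_div_3exp R 8.
have limD : prob_no_isolated p n - prob_connected p n @[n --> \oo] --> (0 : R).
  apply: (squeeze_cvgr _ (cvg_cst 0) limB); near=> n.
  have n324 : (324 <= n)%N by near: n; exact: nbhs_infty_ge.
  rewrite prob_connectedE ?(leq_trans _ n324) //; apply/andP; split.
    exact: subgraph_prob_ge0.
  apply: le_trans (prob_disconnected_bound p_gt0 p_lt1 p_large n324 _) _.
    have : n%:R ^+ 8 / (3 ^ n)%:R <= q ^+ 2 / 4.
      near: n; apply: (cvgr_le _ lim8); by rewrite divr_gt0 ?exprn_gt0.
    rewrite ler_pdivrMr ?ltr0n ?expn_gt0 // => le.
    have -> : (3 ^ n)%:R * q ^+ 2 = 4 * (q ^+ 2 / 4 * (3 ^ n)%:R) by field.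
    by rewrite ler_wpM2l.
  rewrite /B le_eqVlt; apply/orP; left; apply/eqP.
  rewrite invfM; ring.
rewrite -(subr0 l) (_ : prob_connected p =
  (fun n => prob_no_isolated p n - (prob_no_isolated p n - prob_connected p n))).
  exact: cvgB.
by apply/funext => n; rewrite subKr.
Unshelve. all: by end_near.
Qed.

(** At the critical value [q ^ (2 n) = 1 / N], so the two moment inequalities squeeze the ratio of
    consecutive moments to [1 / (j + 1)]. *)
Lemma cvg_cube_moment j : 3 * q ^+ 2 = 1 ->
  cube_moment j n @[n --> \oo] --> (j`!%:R^-1 : R).
Proof.
move=> p_crit; elim: j => [|j IH].
  rewrite fact0 invr1; apply: cvg_near_cst; near=> n; exact: cube_moment0.
(* The powers [0] and [1] of [n] are kept to match [cvg_exprn_div_3exp]. *)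
pose a (n : nat) : R := 1 - j%:R * (n%:R ^+ 0 / (3 ^ n)%:R).
pose b (n : nat) : R := 1 + 2 * j%:R / q ^+ j * (n%:R ^+ 1 / (3 ^ n)%:R).
have lima : a n @[n --> \oo] --> (1 : R).
  rewrite -[1 in X in _ --> X]subr0 -(mulr0 j%:R); apply: cvgB; first exact: cvg_cst.
  by apply: cvgM; [exact: cvg_cst|exact: cvg_exprn_div_3exp].
have limb : b n @[n --> \oo] --> (1 : R).
  rewrite -[1 in X in _ --> X]addr0 -(mulr0 (2 * j%:R / q ^+ j)); apply: cvgD; first exact: cvg_cst.
  by apply: cvgM; [exact: cvg_cst|exact: cvg_exprn_div_3exp].
have eqS (n : nat) : a n * cube_moment j n / j.+1%:R <= cube_moment j.+1 n <=
    b n * cube_moment j n / j.+1%:R.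
  have N0 : (3 ^ n)%:R != 0 :> R by rewrite pnatr_eq0 expn_eq0.
  have qN : q ^+ (2 * n) = (3 ^ n)%:R^-1.
    apply: (mulfI N0); rewrite mean_isolatedE p_crit expr1n divff //.
  rewrite ler_pdivrMr ?ler_pdivlMr ?ltr0n // ![cube_moment j.+1 n * _]mulrC.
  have := isolated_moment_ge p_ge0 p_lt1 (@cube3_adj_sym n) (@cube3_adj_irr n) (@cube_degE n) j.
  have := isolated_moment_le p_ge0 p_lt1 (@cube3_adj_sym n) (@cube3_adj_irr n) (@cube_degE n) j.
  rewrite card_ord qN -/(cube_moment j n) -/(cube_moment j.+1 n) => le ge.
  apply/andP; split.
    apply: le_trans ge; rewrite le_eqVlt; apply/orP; left; apply/eqP.
    by rewrite /a; field.
  apply: le_trans le _; rewrite le_eqVlt; apply/orP; left; apply/eqP.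
  rewrite /b natrM; field; by rewrite N0 expf_neq0 // gt_eqF.
have -> : (j.+1)`!%:R^-1 = 1 * j`!%:R^-1 / j.+1%:R :> R.
  by rewrite factS natrM invfM mul1r mulrC.
apply: squeeze_cvgr.
- by near=> n; exact: eqS.
- by apply: cvgM; [exact: cvgM|exact: cvg_cst].
- by apply: cvgM; [exact: cvgM|exact: cvg_cst].
Unshelve. all: by end_near.
Qed.

Lemma cvg_no_isolated_critical : 3 * q ^+ 2 = 1 ->
  prob_no_isolated p n @[n --> \oo] --> (expR (-1) : R).
Proof.
move=> p_crit; apply: (@cvg_bonferroni R _ cube_moment).
  exact: cube_bonferroni.
by move=> j; exact: cvg_cube_moment.
Qed.

Lemma cvg_no_isolated_supercritical : 3 * q ^+ 2 < 1 ->
  prob_no_isolated p n @[n --> \oo] --> (1 : R).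
Proof.
move=> p_sup; apply/cvgrPdist_le => e e0.
have : (3 * q ^+ 2) ^+ n @[n --> \oo] --> (0 : R).
  by apply: cvg_expr; rewrite ger0_norm // mulr_ge0 ?exprn_ge0 // ltW.
move=> /cvgrPdist_le/(_ _ e0); apply: filterS => n /=.
rewrite sub0r normrN ger0_norm ?exprn_ge0 ?mulr_ge0 ?exprn_ge0 ?(ltW q_gt0) //.
rewrite -cube_moment1; apply: le_trans.
(* With one Bonferroni term the error is the mean number of isolated vertices. *)
by have := cube_bonferroni 1 n; rewrite big_ord1 expr0 mul1r cube_moment0 distrC.
Qed.

(** Dividing the second moment bound by [lam ^ 2] leaves [1 / lam + 2 n / (q N)], and the mean [lam]
    grows geometrically. *)
Lemma cvg_no_isolated_subcritical : 1 < 3 * q ^+ 2 ->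
  prob_no_isolated p n @[n --> \oo] --> (0 : R).
Proof.
move=> p_sub.
pose r := (3 * q ^+ 2)^-1.
pose b (n : nat) : R := r ^+ n + 2 / q * (n%:R ^+ 1 / (3 ^ n)%:R).
have lam0 : 0 < 3 * q ^+ 2 by rewrite mulr_gt0 ?exprn_gt0.
have limb : b n @[n --> \oo] --> (0 : R).
  rewrite -[0 in X in _ --> X]addr0 -[X in _ + X](mulr0 (2 / q)); apply: cvgD.
    by apply: cvg_expr; rewrite ger0_norm ?invr_ge0 ?(ltW lam0) // invf_lt1.
  by apply: cvgM; [exact: cvg_cst|exact: cvg_exprn_div_3exp].
apply: (squeeze_cvgr _ (cvg_cst 0) limb); near=> n; apply/andP; split.
  exact: subgraph_prob_ge0.
have := second_moment_no_isolated p_ge0 p_lt1 (@cube3_adj_sym n) (@cube3_adj_irr n) (@cube_degE n).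
rewrite card_ord mean_isolatedE; set lam := (3 * q ^+ 2) ^+ n => le.
have lamn0 : 0 < lam by rewrite exprn_gt0.
rewrite -(@ler_pM2r _ (lam ^+ 2)) ?exprn_gt0 //; apply: le_trans le _.
rewrite le_eqVlt; apply/orP; left; apply/eqP.
rewrite /b /r exprVn -/lam natrM; field.
by rewrite (gt_eqF lamn0) (gt_eqF q_gt0) pnatr_eq0 expn_eq0.
Unshelve. all: by end_near.
Qed.

Lemma cvg_connected_subcritical : 1 < 3 * q ^+ 2 ->
  prob_connected p n @[n --> \oo] --> (0 : R).
Proof.
move=> p_sub; apply: (squeeze_cvgr _ (cvg_cst 0) (cvg_no_isolated_subcritical p_sub)).
near=> n; apply/andP; split; first exact: subgraph_prob_ge0.
rewrite -subr_ge0 prob_connectedE; last by near: n; exact: nbhs_infty_ge.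
exact: subgraph_prob_ge0.
Unshelve. all: by end_near.
Qed.

Lemma p_cE : 3 * (1 - p_c R) ^+ 2 = 1.
Proof.
have s0 : Num.sqrt (3 : R) != 0 by rewrite gt_eqF // sqrtr_gt0.
have -> : 1 - p_c R = (Num.sqrt 3)^-1 by rewrite /p_c; field.
by rewrite exprVn sqr_sqrtr // divff.
Qed.

Lemma p_c_le1 : p_c R <= 1.
Proof.
have s0 : 0 < Num.sqrt (3 : R) by rewrite sqrtr_gt0.
by rewrite /p_c ler_pdivrMr // mul1r lerBlDr lerDl.
Qed.

End CubeThreshold.

Theorem mainTheorem2 (R : realType) (p : R) (hp0 : 0 < p) (hp1 : p < 1) :
  [/\ p < p_c R ->
        prob_no_isolated p n @[n --> \oo] --> (0 : R) /\
        prob_connected p n @[n --> \oo] --> (0 : R),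
      p = p_c R ->
        prob_no_isolated p n @[n --> \oo] --> (expR (-1) : R) /\
        prob_connected p n @[n --> \oo] --> (expR (-1) : R)
    & p > p_c R ->
        prob_no_isolated p n @[n --> \oo] --> (1 : R) /\
        prob_connected p n @[n --> \oo] --> (1 : R)].
Proof.
have q_ge0 : 0 <= 1 - p by rewrite subr_ge0 ltW.
have qc_ge0 : 0 <= 1 - p_c R by rewrite subr_ge0 p_c_le1.
split=> [lt|eq|gt].
- have p_sub : 1 < 3 * (1 - p) ^+ 2.
    by rewrite -[ltLHS](p_cE R) ltr_pM2l // ltr_pXn2r ?nnegrE // ltrD2l ltrN2.
  by split; [exact: cvg_no_isolated_subcritical|exact: cvg_connected_subcritical].
- have p_crit : 3 * (1 - p) ^+ 2 = 1 by rewrite eq p_cE.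
  have lim := cvg_no_isolated_critical hp0 hp1 p_crit.
  by split=> //; apply: cvg_prob_connected => //; rewrite p_crit.
have p_sup : 3 * (1 - p) ^+ 2 < 1.
  by rewrite -[ltRHS](p_cE R) ltr_pM2l // ltr_pXn2r ?nnegrE // ltrD2l ltrN2.
have lim := cvg_no_isolated_supercritical hp0 hp1 p_sup.
by split=> //; apply: cvg_prob_connected => //; exact: ltW.
Qed.
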